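(* Let $h\colon\mathbb{N}\to[1,\infty)$ with $h(n)\to\infty$ and let $M_n=M_n^{(p_k,z_k)_k}$ be the randomized algorithm defined in the context. Let $\alpha>1/2$, let $\gamma=(\gamma_u)_u$ be weights with $0<\gamma_u\le1$, $d\in\mathbb{N}$, $\lambda\in(1/2,\alpha)$ and $\delta\in(0,\min\{\lambda-1/2,1\})$. Then there is a constant $C_{\lambda,\delta}>0$ depending only on $\lambda,\delta$ such that for all $f\in\mathcal{H}_{d,\alpha,\gamma}$ and all $n$ with $n\ge64\,V_d(\alpha/\lambda,\gamma^{1/\lambda})$ and $h(n)\ge\lambda+1/2$, $$\mathbb{E}\,|I_d(f)-M_n^{(p_k,z_k)_k}(f)|\le C_{\lambda,\delta}\,V_d(\alpha/\lambda,\gamma^{1/\lambda})^{\lambda}\,n^{-\lambda-1/2+\delta}\,\|f\|_{d,\alpha,\gamma}.$$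
   Context: $\{1:m\}:=\{1,\ldots,m\}$. Weights $\gamma=(\gamma_u)_u$ indexed by finite $u\subset\mathbb{N}$, $0<\gamma_u\le1$, $\gamma_\emptyset=1$. For $h\in\mathbb{Z}^d$, $\mathrm{supp}(h)=\{j:h_j\ne0\}$, $r_{d,\alpha,\gamma}(h)=\gamma_{\mathrm{supp}(h)}^{-1}\prod_{j\in\mathrm{supp}(h)}|h_j|^\alpha$. The weighted Korobov space $\mathcal{H}_{d,\alpha,\gamma}$ consists of $f\colon[0,1]^d\to\mathbb{C}$ with absolutely convergent Fourier series $f=\sum_h\hat f(h)e^{2\pi ih\cdot x}$ and finite norm $\|f\|_{d,\alpha,\gamma}^2=\sum_h r_{d,\alpha,\gamma}(h)^2|\hat f(h)|^2$. $I_d(f)=\int_{[0,1]^d}f$. Lattice rule $Q_p^z(f)=\frac1p\sum_{k=0}^{p-1}f(\{kz/p\})$ with $\{\cdot\}$ the componentwise fractional part. $V_d(\alpha/\lambda,\gamma^{1/\lambda})=\sum_{\emptyset\ne u\subseteq\{1:d\}}\gamma_u^{1/\lambda}(2\zeta(\alpha/\lambda))^{|u|}$ with $\zeta$ the Riemann zeta function. Algorithm: $\mathcal{P}_n$ is the set of primes in $[\lceil n/2\rceil+1,n]$; $N=2\lceil h(n)\log_2 n\rceil+1$. For $k=1,\ldots,N$ independently, choose $p_k$ uniformly from $\mathcal{P}_n$ and then $z_k$ uniformly from $\{1:p_k-1\}^d$; set $M_n^{(p_k,z_k)_k}(f)=\mathrm{median}\{Q_{p_k}^{z_k}(f):1\le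 k\le N\}$, where the median of complex numbers is taken separately for real and imaginary parts. The expectation is over $(p_k,z_k)_{k=1}^N$. *)

(* Defs.v *)
From Stdlib Require Import Reals.
From Coquelicot Require Import Coquelicot.
From mathcomp Require Import all_boot finmap.
Set Implicit Arguments. Unset Strict Implicit. Unset Printing Implicit Defensive.

Open Scope R_scope.

(* a point of R^d is a function 'I_d -> R (coordinate j+1 of the paper is j) *)
Definition ptcons (d : nat) (t : R) (y : 'I_d -> R) : 'I_d.+1 -> R :=
  fun i => match unlift ord0 i with Some j => y j | None => t end.

Fixpoint Iint (d : nat) : (('I_d -> R) -> C) -> C :=
  match d as d0 return (('I_d0 -> R) -> C) -> C with
  | 0 => fun f => f (fun _ => 0)
  | d'.+1 => fun f =>
      @RInt C_R_CompleteNormedModule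
        (fun t => Iint (fun y : 'I_d' -> R => f (ptcons t y))) 0 1
  end.

Definition e2pi (theta : R) : C := (cos (2 * PI * theta), sin (2 * PI * theta)).

Definition dotZR (d : nat) (h : 'I_d -> Z) (x : 'I_d -> R) : R :=
  \big[Rplus/0]_(j < d) (IZR (h j) * x j).

Definition fhat (d : nat) (f : ('I_d -> R) -> C) (h : 'I_d -> Z) : C :=
  Iint (fun x => Cmult (f x) (e2pi (- dotZR h x))).

Definition boxpt (d N : nat) (g : {ffun 'I_d -> 'I_(2 * N + 1)}) : 'I_d -> Z :=
  fun j => (Z.of_nat (g j) - Z.of_nat N)%Z.

Definition boxsumR (d N : nat) (F : ('I_d -> Z) -> R) : R :=
  \big[Rplus/0]_(g : {ffun 'I_d -> 'I_(2 * N + 1)}) F (boxpt g).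

Definition boxsumC (d N : nat) (F : ('I_d -> Z) -> C) : C :=
  \big[Cplus/RtoC 0]_(g : {ffun 'I_d -> 'I_(2 * N + 1)}) F (boxpt g).

(* the subset {j+1 : P j} of N (coordinates numbered from 1 as in the paper) *)
Definition toFS (d : nat) (P : pred 'I_d) : {fset nat} :=
  [fset (nat_of_ord j).+1 | j in [seq j <- enum 'I_d | P j]]%fset.

Definition supp (d : nat) (h : 'I_d -> Z) : {fset nat} :=
  toFS (fun j => ~~ Z.eqb (h j) 0).

Definition rw (d : nat) (alpha : R) (gamma : {fset nat} -> R) (h : 'I_d -> Z) : R :=
  / gamma (supp h) *
  \big[Rmult/1]_(j < d | ~~ Z.eqb (h j) 0) Rpower (IZR (Z.abs (h j))) alpha.

Definition inKorobov (d : nat) (alpha : R) (gamma : {fset nat} -> R)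
  (f : ('I_d -> R) -> C) : Prop :=
  (exists M, forall N, boxsumR N (fun h => Cmod (fhat f h)) <= M) /\
  (forall x : 'I_d -> R, (forall j, 0 <= x j <= 1) ->
     filterlim (fun N => boxsumC N (fun h => Cmult (fhat f h) (e2pi (dotZR h x))))
       eventually (locally (f x))) /\
  (exists M, forall N,
     boxsumR N (fun h => (rw alpha gamma h) ^ 2 * (Cmod (fhat f h)) ^ 2) <= M).

Definition korobovNorm (d : nat) (alpha : R) (gamma : {fset nat} -> R)
  (f : ('I_d -> R) -> C) : R :=
  sqrt (real (Lim_seq (fun N =>
     boxsumR N (fun h => (rw alpha gamma h) ^ 2 * (Cmod (fhat f h)) ^ 2)))).

Definition zeta (s : R) : R := Series (fun n => Rpower (INR n.+1) (- s)).

Definition Vd (d : nat) (alpha lam : R) (gamma : {fset nat} -> R) : R :=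
  \big[Rplus/0]_(u : {set 'I_d} | u != set0)
     (Rpower (gamma (toFS (mem u))) (1 / lam) * (2 * zeta (alpha / lam)) ^ #|u|).

Definition primesP (n : nat) : seq nat :=
  [seq p <- iota (uphalf n).+1 (n - uphalf n) | prime p].

Definition ceilR (x : R) : Z := (- Int_part (- x))%Z.

Definition Nsamp (h : nat -> R) (n : nat) : nat :=
  (2 * Z.to_nat (ceilR (h n * (ln (INR n) / ln 2))) + 1)%N.

Definition latticeRule (d : nat) (f : ('I_d -> R) -> C) (p : nat) (z : 'I_d -> nat) : C :=
  Cmult (RtoC (/ INR p))
    (\big[Cplus/RtoC 0]_(k < p)
        f (fun j => frac_part (INR k * INR (z j) / INR p))).

Definition Rleb (x y : R) : bool := if Rle_dec x y then true else false.

Definition medianR (s : seq R) : R := nth 0 (sort Rleb s) (size s)./2.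

Definition medianC (s : seq C) : C := (medianR (map Re s), medianR (map Im s)).

Definition Mn (d : nat) (f : ('I_d -> R) -> C) (ds : seq (nat * ('I_d -> nat))) : C :=
  medianC [seq latticeRule f x.1 x.2 | x <- ds].

(* Expectation over k independent draws (p, z): p uniform in P_n, then
   z uniform in {1,...,p-1}^d. *)
Fixpoint Edraws (d n k : nat) (g : seq (nat * ('I_d -> nat)) -> R) : R :=
  match k with
  | 0 => g [::]
  | k'.+1 =>
      / INR (size (primesP n)) *
      \big[Rplus/0]_(p <- primesP n)
        (/ INR (p.-1 ^ d) *
         \big[Rplus/0]_(w : {ffun 'I_d -> 'I_(p.-1)})
            Edraws n k' (fun l => g ((p, fun j => (nat_of_ord (w j)).+1) :: l)))
  end.

Definition expectedError (d : nat) (h : nat -> R) (n : nat) (f : ('I_d -> R) -> C) : R :=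
  Edraws n (Nsamp h n) (fun ds => Cmod (Cminus (Iint f) (Mn f ds))).

(* Main.v *)
Require Import Defs.
From Stdlib Require Import ZArith Reals Lra Lia.
From Stdlib Require Import FunctionalExtensionality Classical ClassicalEpsilon.
From Coquelicot Require Import Coquelicot.
From HB Require Import structures.
From mathcomp Require Import all_boot finmap zify.
Open Scope R_scope.
Set Implicit Arguments. Unset Strict Implicit. Unset Printing Implicit Defensive.

(** Write [c h] for the Fourier coefficients and [r h] for the Korobov weight. Then [I f = c 0],
    and the error of the lattice rule [(p, z)] is the sum of [c h] over the nonzero dual
    vectors [h], those with [p | h.z]. Call [(p, z)] good if every nonzero dual vector has
    [r h >= R0 = (n / (128 V))^lam].

    A fixed [h <> 0] is dual with probability at most [2/n + w/|P_n|], where [w] counts the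
    primes of [P_n] dividing a nonzero coordinate [h_j]. If [r h < R0] then [|h_j| < n/2], so
    [w = 0], and since [sum r^(-1/lam) <= V] a draw is bad with probability at most 1/64. In
    general [2^w <= |h_j|], so [w = O(|h_j|^(del/2))], and [|P_n| >= c n^(1 - del/2)] by
    Chebyshev's argument on the central binomial coefficient; hence, by Cauchy-Schwarz on the
    tail [r h >= R0], the expected error restricted to good draws is
    [O(V^lam n^(-lam - 1/2 + del) |f|)].

    Among [2T + 1] draws, at least [T + 1] have an error at least as large as that of the
    median. Unless more than [T/2] draws are bad, about half of these are good, so the error
    of the median is at most [4/(T+1)] times the total error of the good draws, whose
    expectation costs only a constant factor. The exceptional event is controlled by the
    exponential moment of the number of bad draws: its probability is at most [2^(-T)], and
    there the error is at most [|f| V^lam]. *)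

(** * Primes in (n/2, n] *)

Section Primes.
Local Open Scope nat_scope.

(** Distinct primes are pairwise coprime, so their divisibilities multiply. This serves both the
    primorial bound and the count of primes dividing a frequency. *)
Lemma prod_primes_dvdn (s : seq nat) m :
  uniq s -> all prime s -> all (fun p => p %| m) s -> \prod_(p <- s) p %| m.
Proof.
elim: s => [|p s IH] /=; first by rewrite big_nil dvd1n.
move=> /andP[pNs us] /andP[pp ps] /andP[pm sm].
rewrite big_cons Gauss_dvd ?pm ?IH //.
rewrite prime_coprime //; apply/negP; rewrite Euclid_dvd_prod // big_has.
move=> /hasP[q qs]; rewrite dvdn_prime2 //; last exact: (allP ps).
by move=> /eqP epq; rewrite epq qs in pNs.
Qed.

(** The two middle coefficients of [(1 + 1)^(2k+1)] are equal, and together they are at most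
    [2 * 4^k]. *)
Lemma leq_bin_odd k : 'C(k.*2.+1, k) <= 4 ^ k.
Proof.
have e : 'C(k.*2.+1, k.+1) = 'C(k.*2.+1, k).
  by rewrite -bin_sub; [congr 'C(_, _); lia|lia].
have : 'C(k.*2.+1, k) + 'C(k.*2.+1, k.+1) <= 2 ^ k.*2.+1.
  rewrite -[2]/(1 + 1) expnDn.
  under eq_bigr => i _ do rewrite !exp1n !muln1.
  have h1 : k < k.*2.+2 by lia.
  have h2 : k.+1 < k.*2.+2 by lia.
  rewrite (bigD1 (Ordinal h1)) //= (bigD1 (Ordinal h2)) /=; first by lia.
  by apply/eqP => /(congr1 val) /=; lia.
rewrite e expnS -mul2n expnM -[2 ^ 2]/4.
by move: (4 ^ k) 'C(_, _) => a b; lia.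
Qed.

(** Induction: the absorption identity, used twice, gives [(2n+2) C(2n+2, n+1) = 4 (2n+1) C(2n, n)],
    and [2n+1 >= 2n]. *)
Lemma leq_central_bin m : 0 < m -> 4 ^ m <= m.*2 * 'C(m.*2, m).
Proof.
elim: m => // -[_ _ //|m IH _].
have := IH isT; set n := m.+1.
have := mul_bin_diag n.*2.+1 n; have := mul_bin_diag n.*2.+2 n => /=.
have -> : 'C(n.*2.+1, n) = 'C(n.*2.+1, n.+1).
  by rewrite -bin_sub; [congr 'C(_, _); lia|lia].
rewrite doubleS expnS; set a := 'C(_, _); set b := 'C(_, _); set c := 'C(_, _).
move: (4 ^ n) => e; nia.
Qed.

(** Erdős's induction. An even [n > 2] is not prime and adds nothing. For [n = 2k+1] the primes up
    to [k+1] fall under the induction hypothesis, and the product of those in [(k+1, 2k+1]] divides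
    [C(2k+1, k) <= 4^k]. *)
Lemma leq_primorial n : \prod_(0 <= p < n.+1 | prime p) p <= 4 ^ n.
Proof.
elim/ltn_ind: n => n IH.
case: (leqP n 2) => [|n_gt2].
  by case: n {IH} => [|[|[|]]] //; rewrite !big_mkcond !big_nat_recr ?big_geq.
case: (boolP (odd n)) => [on|en]; last first.
  rewrite big_mkcond big_nat_recr //= -big_mkcond /=.
  have -> : prime n = false.
    by apply/negP => /even_prime [|]; [lia|move=> o; rewrite o in en].
  rewrite muln1; case: n n_gt2 en IH => // n _ _ IH.
  by apply: leq_trans (IH n _) _ => //; rewrite leq_exp2l.
pose k := n./2.
have en : n = k.*2.+1 by have := odd_double_half n; rewrite on -/k; lia.
rewrite (@big_cat_nat _ _ _ k.+2) //=; last by lia.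
have h1 := IH k.+1 ltac:(lia).
have -> : 4 ^ n = 4 ^ k.+1 * 4 ^ k by rewrite -expnD; congr (_ ^ _); lia.
apply: leq_mul => //.
apply: leq_trans (leq_bin_odd k).
apply: dvdn_leq; first by rewrite bin_gt0; lia.
rewrite -big_filter; apply: prod_primes_dvdn.
- exact/filter_uniq/iota_uniq.
- exact: filter_all.
- apply/allP => p; rewrite mem_filter mem_index_iota => /andP[pp /andP[lp up]].
  have := bin_fact (n := k.*2.+1) (m := k) ltac:(lia).
  (* Such a [p] divides [(2k+1)!] but neither [k!] nor [(k+1)!], hence it divides the binomial
     coefficient. *)
  have pN j : j < p -> ~~ (p %| j`!).
    move=> jp; rewrite fact_prod Euclid_dvd_prod // big_has; apply/hasP => -[i].
    by rewrite mem_index_iota => /andP[i0 ij] /dvdn_leq; lia.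
  have pD : p %| (k.*2.+1)`! by apply: dvdn_fact; lia.
  move=> e; rewrite -e Euclid_dvdM // Euclid_dvdM // in pD.
  rewrite (negbTE (pN k _)) ?(negbTE (pN (k.*2.+1 - k) _)) ?orbF // in pD; lia.
Qed.

Lemma divn_double_diff m q : 0 < q -> m.*2 %/ q = (m %/ q).*2 + (q <= (m %% q).*2).
Proof.
move=> q0; have h := ltn_pmod m q0.
rewrite {1}(divn_eq m q) doubleD doubleMl divnMDl //; congr (_ + _).
case: leqP => c; last by rewrite divn_small.
by apply/eqP; rewrite eqn_leq leq_divRL // -ltnS ltn_divLR //; lia.
Qed.

(** Legendre's formula for [(2m)!] and [m!]: each power [p^k] contributes 0 or 1, according to
    whether adding [m] to itself in base [p] carries at position [k]. *)
Lemma logn_central_bin p m : prime p ->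
  logn p 'C(m.*2, m) = \sum_(1 <= k < m.*2.+1) (p ^ k <= (m %% p ^ k).*2).
Proof.
move=> pp.
have := bin_fact (n := m.*2) (m := m) ltac:(lia).
have -> : m.*2 - m = m by lia.
move=> /(congr1 (logn p)).
rewrite !lognM ?muln_gt0 ?fact_gt0 ?bin_gt0 //; last by lia.
rewrite !logn_fact //.
(* Both Legendre sums are brought to the same range; the added terms vanish because [p^k > m]. *)
have -> : \sum_(1 <= k < m.+1) m %/ p ^ k = \sum_(1 <= k < m.*2.+1) m %/ p ^ k.
  rewrite [RHS](@big_cat_nat _ _ _ m.+1) //=; last by lia.
  rewrite [X in _ = _ + X]big_nat_cond [X in _ = _ + X]big1 ?addn0 // => k /andP[/andP[km _] _].
  apply: divn_small; apply: leq_trans km _.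
  by apply: ltnW; apply: ltn_expl; apply: prime_gt1.
under [X in _ = X]eq_bigr => k _ do
  rewrite divn_double_diff ?expn_gt0 ?prime_gt0 //.
rewrite big_split /= -(big_morph double doubleD (erefl : 0.*2 = 0)) -addnn.
by move: (\sum_(_ <= _ < _) m %/ _) => S; lia.
Qed.

(** Each exponent [k] with [p^k <= 2m] contributes at most 1 and the larger ones contribute 0, so
    the valuation is at most the integer logarithm of [2m] in base [p]. *)
Lemma expn_logn_central_bin p m : prime p -> 0 < m -> p ^ logn p 'C(m.*2, m) <= m.*2.
Proof.
move=> pp m0; have p1 := prime_gt1 pp.
apply: leq_trans (trunc_logP (p := p) (n := m.*2) p1 _); last by lia.
rewrite leq_exp2l // logn_central_bin //.
set t := trunc_log p m.*2.
have tm : t.+1 <= m.*2.+1.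
  have := trunc_logP (p := p) (n := m.*2) p1 ltac:(lia); rewrite -/t.
  by have := ltn_expl t p1; lia.
rewrite (@big_cat_nat _ _ _ t.+1) //= [X in _ + X]big_nat_cond [X in _ + X]big1 ?addn0.
  rewrite -[X in _ <= X]subn0 -(subSS 0 t) -[X in _ <= X]muln1 -sum_nat_const_nat.
  by apply: leq_sum => i _; exact: leq_b1.
move=> k /andP[/andP[tk _] _]; apply/eqP; rewrite eqb0 -ltnNge.
apply: (@leq_ltn_trans m.*2); first by rewrite leq_double leq_mod.
by apply: leq_trans (trunc_log_ltn _ p1) _; rewrite leq_exp2l.
Qed.

(** No carry occurs: at the first position the residue [m - p] satisfies [2(m - p) < p], and from
    the second on [p^k >= 3p > 2m]. *)
Lemma logn_central_bin_eq0 p m : prime p -> 2 < p -> m.*2 < 3 * p -> p <= m ->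
  logn p 'C(m.*2, m) = 0.
Proof.
move=> pp p2 mp pm.
rewrite logn_central_bin // big_nat_cond big1 // => k /andP[/andP[k0 _] _].
apply/eqP; rewrite eqb0 -ltnNge.
case: k k0 => // -[_|k _].
  rewrite expn1.
  have -> : m %% p = m - p.
    by rewrite -{1}(subnK pm) modnDr modn_small; lia.
  by lia.
rewrite !expnS; apply: (@leq_ltn_trans m.*2); first by rewrite leq_double leq_mod.
have : 0 < p ^ k by rewrite expn_gt0; lia.
by move: (p ^ k) => e; nia.
Qed.

(** For even [n] the two windows agree. For odd [n = 2m+1] the window of [primesP] starts at [m+2]
    and may miss the prime [m+1], which accounts for the successor on the right. *)
Lemma size_primesP n :
  \sum_(0 <= p < (n./2).*2.+1 | prime p) (n./2 < p) <= (size (primesP n)).+1.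
Proof.
rewrite (@big_cat_nat _ _ _ n./2.+1) //=; last by lia.
rewrite big_nat_cond big1 ?add0n; last by move=> i; lia.
apply: (@leq_trans (size [seq p <- iota n./2.+1 n./2 | prime p])).
  have -> : index_iota n./2.+1 (n./2).*2.+1 = iota n./2.+1 n./2.
    by rewrite /index_iota; congr iota; lia.
  rewrite size_filter -sum1_count.
  by apply: leq_sum => i _; exact: leq_b1.
rewrite /primesP.
have -> : n - uphalf n = n./2.
  by have := odd_double_half n; rewrite uphalf_half; lia.
rewrite uphalf_half; case: (odd n) => /=; rewrite ?add0n ?add1n //.
case: (n./2) => // m.
have -> : iota m.+2 m.+1 = m.+2 :: iota m.+3 m by [].
have -> : iota m.+3 m.+1 = iota m.+3 m ++ [:: m.+3 + m] by rewrite -(iotaD _ m 1) addn1.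
by rewrite filter_cat size_cat [filter _ (_ :: _)]/=; case: ifP => _ /=; lia.
Qed.

(** Put [m = n./2] and factor [C(2m, m)]. A prime above [m] or at most [s] contributes at most [n];
    there are at most [|P_n| + 1] and [s + 1] of these. A prime in [(s, n/3]] has [p^2 > n], hence
    exponent at most 1, and together these are bounded by the primorial. Primes in [(n/3, m]] do not
    occur. The factor [2m <= n] in front of the coefficient raises the exponent to
    [|P_n| + s + 3]. *)
Lemma leq_expn4_primesP n s : 1 < n -> n < s.+1 ^ 2 ->
  4 ^ n./2 <= n ^ (size (primesP n) + s + 3) * 4 ^ (n %/ 3).
Proof.
move=> n1 ns; set m := n./2.
have m0 : 0 < m by rewrite /m; lia.
have mn : m.*2 <= n by rewrite /m; lia.
apply: leq_trans (leq_central_bin m0) _.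
set c := 'C(m.*2, m).
have c0 : 0 < c by rewrite bin_gt0; lia.
have cE : c = \prod_(0 <= p < m.*2.+1 | prime p) p ^ logn p c.
  have := widen_partn predT (leq_addr m.*2 c); rewrite partnT // => {1}->.
  rewrite (@big_cat_nat _ _ _ m.*2.+1) //=; last by lia.
  rewrite [X in _ * X]big_nat_cond [X in _ * X]big1 ?muln1; last first.
    move=> p /andP[/andP[pm _] _]; case: (boolP (prime p)) => pp; last first.
      by rewrite lognE (negbTE pp).
    have := expn_logn_central_bin pp m0; rewrite -/c.
    case: (logn p c) => // k; rewrite expnS.
    have : 0 < p ^ k by rewrite expn_gt0 prime_gt0.
    by move: (p ^ k) => e; nia.
  rewrite [RHS]big_mkcond; apply: eq_bigr => p _ /=.
  by case: (boolP (prime p)) => pp //; rewrite lognE (negbTE pp).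
have : c <= n ^ (size (primesP n) + s + 2) * 4 ^ (n %/ 3).
  rewrite {1}cE.
  apply: (@leq_trans (\prod_(0 <= p < m.*2.+1 | prime p)
     (n ^ ((m < p) + (p <= s)) * (if p <= n %/ 3 then p else 1)))).
    rewrite big_mkcond [X in _ <= X]big_mkcond /=.
    apply: leq_prod => p _; case: ifP => // pp.
    have b1 := expn_logn_central_bin pp m0; rewrite -/c in b1.
    have p1 := prime_gt1 pp.
    have fin : p ^ logn p c <= p -> p <= n %/ 3 -> p ^ logn p c <= n ^ ((m < p) + (p <= s)) * p.
      by move=> h _; apply: leq_trans h _; rewrite leq_pmull // expn_gt0; lia.
    have big : (m < p) || (p <= s) -> p ^ logn p c <= n ^ ((m < p) + (p <= s)).
      move=> h; apply: leq_trans b1 _; apply: leq_trans mn _.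
      by rewrite -{1}[n]expn1 leq_exp2l //; move: h; case: (_ < _); case: (_ <= _).
    case: (boolP ((m < p) || (p <= s))) => [h|].
      apply: leq_trans (big h) _; rewrite leq_pmulr //; case: ifP; lia.
    rewrite negb_or -leqNgt -ltnNge => /andP[pm sp].
    have -> : (m < p) = false by lia.
    have -> : (p <= s) = false by lia.
    rewrite mul1n.
    case: (leqP p (n %/ 3)) => pn.
      case: (ltnP 1 (logn p c)) => l; last first.
        by rewrite -[X in _ <= X]expn1 leq_exp2l.
      have : p ^ 2 <= p ^ logn p c by rewrite leq_exp2l.
      have : s.+1 ^ 2 <= p ^ 2 by rewrite leq_exp2r.
      by lia.
    rewrite logn_central_bin_eq0 //; first by nia.
    rewrite ltn_divLR // in pn; lia.
  rewrite big_split /=; apply: leq_mul.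
    rewrite -expn_sum leq_exp2l // big_split /=.
    have h := size_primesP n; rewrite -/m in h.
    have h' : \sum_(0 <= p < m.*2.+1 | prime p) (p <= s) <= s.+1.
      apply: (@leq_trans (\sum_(0 <= p < m.*2.+1) (p <= s))).
        by rewrite big_mkcond leq_sum // => p _; case: (prime p).
      elim: (m.*2.+1) => [|K IH]; first by rewrite big_geq.
      rewrite big_nat_recr //=; case: (leqP K s) => Ks; last by rewrite addn0.
      rewrite addn1 ltnS; apply: leq_trans Ks.
      rewrite -[X in _ <= X]subn0 -[X in _ <= X]muln1 -sum_nat_const_nat.
      by apply: leq_sum => i _; exact: leq_b1.
    by apply: leq_trans (leq_add h h') _; lia.
  rewrite (@big_cat_nat _ _ _ (n %/ 3).+1) //=; last by rewrite /m; lia.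
  rewrite [X in _ * X]big_nat_cond [X in _ * X]big1 ?muln1; last first.
    by move=> p /andP[/andP[pn _] _]; rewrite leqNgt pn.
  apply: leq_trans (leq_primorial _).
  rewrite big_nat_cond [X in _ <= X]big_nat_cond.
  by apply: leq_prod => p /andP[_ pp]; case: ifP => // _; exact: prime_gt0.
move=> h; apply: (leq_trans (leq_mul mn h)).
by rewrite mulnA -expnS -addnS.
Qed.
End Primes.

(** * Chebyshev's lower bound in real form *)

Lemma Rpower_gt0 x y : 0 < Rpower x y.
Proof. exact: exp_pos. Qed.

Lemma ln_le_Rpower eta x : 0 < eta -> 0 < x -> ln x <= Rpower x eta / eta.
Proof.
move=> e0 x0; apply: (Rmult_le_reg_r eta) => //.
rewrite /Rdiv Rmult_assoc Rinv_l ?Rmult_1_r; last by lra.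
rewrite /Rpower; have := exp_ineq1_le (eta * ln x); lra.
Qed.

Lemma INR_expn a b : INR (a ^ b) = INR a ^ b.
Proof. by elim: b => [|b IH]; rewrite ?expn0 // expnS mult_INR IH. Qed.

Lemma INR_leq a b : (a <= b)%N -> INR a <= INR b.
Proof. by move=> ab; apply: le_INR; lia. Qed.

Lemma INR_half_ge n : (INR n - 1) / 2 <= INR n./2.
Proof.
have : INR n <= INR (n./2 + n./2 + 1) by apply: INR_leq; lia.
by rewrite !plus_INR /=; lra.
Qed.

(** Logarithm of the previous inequality with [s] the integer square root of [n]. For [n >= 6] one
    has [(n-1)/2 - n/3 >= n/12], and [ln 4 >= 1]. *)
Lemma chebyshev_primesP n : (6 <= n)%N ->
  INR n / 12 <= (INR (size (primesP n)) + sqrt (INR n) + 3) * ln (INR n).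
Proof.
move=> n6; pose s := Nat.sqrt n.
have [s1 s2] := Nat.sqrt_spec n ltac:(lia).
rewrite -/s in s1 s2.
have nR : 6 <= INR n by have := INR_leq n6; rewrite /=; lra.
have ss : INR s <= sqrt (INR n).
  rewrite -(sqrt_square (INR s)); last exact: pos_INR.
  by apply: sqrt_le_1_alt; rewrite -mult_INR; apply: le_INR.
have := @leq_expn4_primesP n s ltac:(lia) ltac:(lia).
move/INR_leq; rewrite mult_INR !INR_expn => H.
have i4 : INR 4 = 4 by rewrite /=; lra.
rewrite i4 in H.
have p4 k : 0 < 4 ^ k by apply: pow_lt; lra.
have := ln_le _ _ (p4 _) H.
rewrite ln_mult ?ln_pow; try lra; try by apply: pow_lt; lra.
rewrite !plus_INR => {}H.
have l4 : 1 <= ln 4.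
  rewrite -(ln_exp 1); apply: ln_le; first exact: exp_pos.
  by have := exp_le_3; lra.
have h2 := INR_half_ge n.
have h3 : INR (n %/ 3) <= INR n / 3.
  have : INR (n %/ 3 + n %/ 3 + n %/ 3) <= INR n by apply: INR_leq; lia.
  by rewrite !plus_INR; lra.
have i3 : INR 3 = 3 by rewrite /=; lra.
rewrite i3 in H.
have ln0 : 0 <= ln (INR n) by rewrite -ln_1; apply: ln_le; lra.
have : INR s * ln (INR n) <= sqrt (INR n) * ln (INR n) by apply: Rmult_le_compat_r.
have : INR n / 12 * 1 <= (INR n./2 - INR (n %/ 3)) * ln 4.
  by apply: Rmult_le_compat; lra.
by rewrite /= in H *; lra.
Qed.

(** The logarithm is absorbed by [ln x <= x^eta / eta]. Below the threshold [n0] a nonempty set has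
    at least one element, and [c <= 1/n0] suffices. The empty set is a separate alternative because
    there the expected error is zero anyway. *)
Lemma primesP_lower eps : 0 < eps -> exists c, 0 < c /\ forall n, (2 <= n)%N ->
  primesP n = [::] \/ c * Rpower (INR n) (1 - eps) <= INR (size (primesP n)).
Proof.
move=> e0; pose eta := Rmin eps (1 / 4).
have [eta0 eta1 eta2] : [/\ 0 < eta, eta <= 1 / 4 & eta <= eps].
  split; [by apply: Rmin_glb_lt; lra | exact: Rmin_r | exact: Rmin_l].
(* Chosen so that [4 sqrt x <= (eta/24) x^(1-eta)] beyond [n0]: since [eta <= 1/4], [x^(1-eta)] is
   at least [x^(1/4) sqrt x]. This absorbs [sqrt x + 3] into half of the main term. *)
pose n0 := Rmax 6 (Rpower (96 / eta) 4).
have n06 : 6 <= n0 by apply: Rmax_l.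
exists (Rmin (eta / 24) (/ n0)); split.
  by apply: Rmin_glb_lt; [lra | apply: Rinv_0_lt_compat; lra].
move=> n n2.
have nR : 2 <= INR n by have := INR_leq n2; rewrite /=; lra.
case: (Rlt_le_dec (INR n) n0) => nn0.
  case: (primesP n) => [|p l]; [by left | right].
  apply: (Rle_trans _ 1); last by rewrite /= -/(INR (size l).+1) S_INR; have := pos_INR (size l); lra.
  apply: (Rle_trans _ (/ n0 * n0)); last by rewrite Rinv_l; lra.
  apply: Rmult_le_compat; [| | exact: Rmin_r |].
  - by apply: Rmin_glb; [lra | apply: Rlt_le; apply: Rinv_0_lt_compat; lra].
  - exact/Rlt_le/Rpower_gt0.
  - apply: (Rle_trans _ (Rpower (INR n) 1)); last by rewrite Rpower_1; lra.
    by apply: Rle_Rpower; lra.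
right; set x := INR n in nR nn0 *.
have n6 : (6 <= n)%N.
  apply/leP; apply: INR_le; rewrite -/x /=; lra.
have H := chebyshev_primesP n6; rewrite -/x in H.
set S := INR _ in H *.
have S0 : 0 <= S by apply: pos_INR.
apply: (Rle_trans _ (eta / 24 * Rpower x (1 - eta))).
  apply: Rmult_le_compat; [| exact/Rlt_le/Rpower_gt0 | exact: Rmin_l |].
  - by apply: Rmin_glb; [lra | apply: Rlt_le; apply: Rinv_0_lt_compat; lra].
  - by apply: Rle_Rpower; lra.
have sq : sqrt x = Rpower x (/ 2) by rewrite Rpower_sqrt; lra.
have s1 : 1 <= sqrt x by rewrite -sqrt_1; apply: sqrt_le_1_alt; lra.
set Y := Rpower x (1 - eta).
have Y0 : 0 < Y by apply: Rpower_gt0.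
have small : 4 * sqrt x <= eta / 24 * Y.
  have x4 : 96 / eta <= Rpower x (1 / 4).
    have : Rpower (Rpower (96 / eta) 4) (1 / 4) <= Rpower x (1 / 4).
      apply: Rle_Rpower_l; first lra; split; first exact: Rpower_gt0.
      by apply: Rle_trans nn0; exact: Rmax_r.
    rewrite Rpower_mult (_ : 4 * (1 / 4) = 1) ?Rpower_1 //; last by lra.
    by apply: Rdiv_lt_0_compat; lra.
  have : Rpower x (1 / 4) * sqrt x <= Y.
    by rewrite sq -Rpower_plus; apply: Rle_Rpower; lra.
  have : 96 / eta * sqrt x <= Rpower x (1 / 4) * sqrt x by apply: Rmult_le_compat_r; lra.
  move=> h1 h2.
  have : eta / 24 * (96 / eta * sqrt x) <= eta / 24 * Y by apply: Rmult_le_compat_l; lra.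
  by rewrite (_ : eta / 24 * (96 / eta * sqrt x) = 4 * sqrt x); [lra | field; lra].
have L := @ln_le_Rpower eta x eta0 ltac:(lra).
set Z := Rpower x eta in L.
have Z0 : 0 < Z by apply: Rpower_gt0.
have YZ : Y * Z = x by rewrite /Y /Z -Rpower_plus (_ : 1 - eta + eta = 1) ?Rpower_1; lra.
have : x / 12 <= (S + sqrt x + 3) * (Z / eta).
  by apply: Rle_trans H _; apply: Rmult_le_compat_l; lra.
rewrite -{1}YZ => H1.
have : eta / 12 * Y <= S + sqrt x + 3.
  apply: (Rmult_le_reg_r (Z / eta)); first by apply: Rdiv_lt_0_compat.
  by rewrite (_ : eta / 12 * Y * (Z / eta) = Y * Z / 12) //; field; lra.
by lra.
Qed.

(** * Finite sums *)

Lemma RplusA : associative Rplus. Proof. by move=> *; ring. Qed.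
Lemma RmultA : associative Rmult. Proof. by move=> *; ring. Qed.
Lemma CplusA : associative Cplus. Proof. by move=> *; ring. Qed.

HB.instance Definition _ := Monoid.isComLaw.Build R 0 Rplus RplusA Rplus_comm Rplus_0_l.
HB.instance Definition _ := Monoid.isComLaw.Build R 1 Rmult RmultA Rmult_comm Rmult_1_l.
HB.instance Definition _ := Monoid.isMulLaw.Build R 0 Rmult Rmult_0_l Rmult_0_r.
HB.instance Definition _ :=
  Monoid.isAddLaw.Build R Rmult Rplus Rmult_plus_distr_r Rmult_plus_distr_l.
HB.instance Definition _ :=
  Monoid.isComLaw.Build C (RtoC 0) Cplus CplusA Cplus_comm Cplus_0_l.

Section SumR.
Context {I : Type}.
Implicit Types (r : seq I) (P Q : pred I) (F G : I -> R).

Lemma sumR_ge0 r P F : (forall i, P i -> 0 <= F i) -> 0 <= \big[Rplus/0]_(i <- r | P i) F i.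
Proof. by move=> h; apply: big_ind => //; [lra | move=> *; lra]. Qed.

Lemma prodR_ge0 r P F : (forall i, P i -> 0 <= F i) -> 0 <= \big[Rmult/1]_(i <- r | P i) F i.
Proof. by move=> h; apply: big_ind => //; [lra | move=> *; apply: Rmult_le_pos]. Qed.

Lemma prodR_gt0 r P F : (forall i, P i -> 0 < F i) -> 0 < \big[Rmult/1]_(i <- r | P i) F i.
Proof. by move=> h; apply: big_ind => //; [lra | move=> *; apply: Rmult_lt_0_compat]. Qed.

Lemma sumR_le r P F G : (forall i, P i -> F i <= G i) ->
  \big[Rplus/0]_(i <- r | P i) F i <= \big[Rplus/0]_(i <- r | P i) G i.
Proof. by move=> h; apply: big_ind2 => //; [lra | move=> *; lra]. Qed.

Lemma sumR_le_cond r P Q F : (forall i, P i -> Q i) -> (forall i, Q i -> 0 <= F i) ->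
  \big[Rplus/0]_(i <- r | P i) F i <= \big[Rplus/0]_(i <- r | Q i) F i.
Proof.
move=> PQ F0; rewrite big_mkcond [X in _ <= X]big_mkcond; apply: sumR_le => i _.
case: (boolP (P i)) => [/PQ ->|_]; first by lra.
by case: (boolP (Q i)) => [/F0|_]; lra.
Qed.

Lemma prodR_le r P F G : (forall i, P i -> 0 <= F i <= G i) ->
  \big[Rmult/1]_(i <- r | P i) F i <= \big[Rmult/1]_(i <- r | P i) G i.
Proof.
move=> h.
suff [] : 0 <= \big[Rmult/1]_(i <- r | P i) F i <= \big[Rmult/1]_(i <- r | P i) G i by [].
elim/big_rec2: _ => [|i x y Pi [x0 xy]]; first by lra.
have [F0 FG] := h _ Pi; split; first exact: Rmult_le_pos.
exact: Rmult_le_compat.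
Qed.

Lemma Rpower_prod r P F z : (forall i, P i -> 0 < F i) ->
  Rpower (\big[Rmult/1]_(i <- r | P i) F i) z = \big[Rmult/1]_(i <- r | P i) Rpower (F i) z.
Proof.
move=> F0; elim: r => [|i r IH]; first by rewrite !big_nil /Rpower ln_1 Rmult_0_r exp_0.
rewrite !big_cons; case: ifP => // Pi.
by rewrite -IH Rpower_mult_distr //; [exact: F0 | exact: prodR_gt0].
Qed.

Lemma sumR_mull r P F c :
  \big[Rplus/0]_(i <- r | P i) (c * F i) = c * \big[Rplus/0]_(i <- r | P i) F i.
Proof. by rewrite big_distrr. Qed.

Lemma sumR_const r P c : \big[Rplus/0]_(i <- r | P i) c = INR (count P r) * c.
Proof.
rewrite -big_filter -size_filter; elim: (filter P r) => [|i s IH].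
  by rewrite big_nil /= Rmult_0_l.
by rewrite big_cons IH [size _]/= S_INR Rmult_plus_distr_r Rmult_1_l Rplus_comm.
Qed.

(** Induction on the sum; the step is the two-dimensional inequality, whose defect is the square
    [(x a - y b)^2]. *)
Lemma cauchy_schwarz r P F G :
  \big[Rplus/0]_(i <- r | P i) (F i * G i) <=
  sqrt (\big[Rplus/0]_(i <- r | P i) (F i ^ 2)) * sqrt (\big[Rplus/0]_(i <- r | P i) (G i ^ 2)).
Proof.
suff [] : [/\ \big[Rplus/0]_(i <- r | P i) (F i * G i) <=
  sqrt (\big[Rplus/0]_(i <- r | P i) (F i ^ 2)) * sqrt (\big[Rplus/0]_(i <- r | P i) (G i ^ 2)),
  0 <= \big[Rplus/0]_(i <- r | P i) (F i ^ 2) & 0 <= \big[Rplus/0]_(i <- r | P i) (G i ^ 2)] by [].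
elim/big_rec3: _ => [|i A B K Pi [h B0 A0]]; first by rewrite sqrt_0; split; lra.
have F2 := pow2_ge_0 (F i); have G2 := pow2_ge_0 (G i).
split; [|lra|lra].
rewrite -sqrt_mult; [|lra|lra].
set b := sqrt B in h; set a := sqrt A in h.
have b0 : 0 <= b := sqrt_pos _; have a0 : 0 <= a := sqrt_pos _.
have bB : b * b = B by rewrite /b sqrt_def.
have aA : a * a = A by rewrite /a sqrt_def.
rewrite -bB -aA; clear b0 a0 bB aA F2 G2; move: b a (F i) (G i) h => b a x y h.
apply: (Rle_trans _ (x * y + b * a)); first by lra.
apply: Rle_trans (Rle_abs _) _.
rewrite -sqrt_Rsqr_abs; apply: sqrt_le_1_alt; rewrite /Rsqr.
by have := pow2_ge_0 (x * a - y * b); lra.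
Qed.

Lemma Cmod_sum r P (F : I -> C) :
  Cmod (\big[Cplus/RtoC 0]_(i <- r | P i) F i) <= \big[Rplus/0]_(i <- r | P i) Cmod (F i).
Proof.
elim/big_rec2: _ => [|i x y _ h]; first by rewrite Cmod_0; lra.
by apply: Rle_trans (Cmod_triangle _ _) _; lra.
Qed.

End SumR.

(** * Boxes of frequencies and the zeta function *)

(** The right side is 1 plus the integral of [x^(-s)] over [[1, n+1]]. Having this closed form, the
    comparison is proved by induction without integrating. *)
Lemma zeta_partial_bound s n : 1 < s ->
  \big[Rplus/0]_(0 <= k < n.+1) Rpower (INR k.+1) (- s) <=
  1 + (1 - Rpower (INR n.+1) (1 - s)) / (s - 1).
Proof.
move=> s1; elim: n => [|n IH].
  rewrite big_nat1 /= /Rpower ln_1 !Rmult_0_r exp_0 Rminus_diag /Rdiv Rmult_0_l; lra.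
rewrite big_nat_recr //=.
apply: Rle_trans (Rplus_le_compat_r _ _ _ IH) _; rewrite -/(INR n.+2).
set y := INR n.+1; set x := INR n.+2.
have y0 : 0 < y by apply: lt_0_INR; lia.
have xy : x = y + 1 by rewrite /x S_INR.
(* Consecutive terms are compared through this logarithmic inequality: exponentiating it gives
   [y^(-a) >= x^(-a) (1 + a/x)]. *)
have lxy : / x <= ln x - ln y.
  have : ln (y / x) <= y / x - 1.
    have h : 0 < y / x by apply: Rdiv_lt_0_compat; lra.
    by have := exp_ineq1_le (ln (y / x)); rewrite exp_ln //; lra.
  rewrite ln_div; [|lra|lra].
  by rewrite (_ : y / x - 1 = - / x); [lra | rewrite xy; field; lra].
pose a := s - 1; have a0 : 0 < a by rewrite /a; lra.
set E := Rpower x (- a).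
have E0 : 0 < E by apply: Rpower_gt0.
have e1 : Rpower x (- s) = E / x.
  rewrite (_ : - s = - a + - (1)); last by rewrite /a; lra.
  by rewrite Rpower_plus -/E Rpower_Ropp Rpower_1; lra.
have e2 : E * (1 + a / x) <= Rpower y (- a).
  rewrite /E /Rpower (_ : - a * ln y = - a * ln x + a * (ln x - ln y)); last by ring.
  rewrite exp_plus; apply: Rmult_le_compat_l; first exact/Rlt_le/exp_pos.
  apply: Rle_trans (exp_ineq1_le _).
  have : a * / x <= a * (ln x - ln y) by apply: Rmult_le_compat_l; lra.
  by rewrite /Rdiv; lra.
rewrite (_ : 1 - s = - a); last by rewrite /a; lra.
rewrite -/E -/a e1.
apply: (Rmult_le_reg_r a) => //.
rewrite Rmult_plus_distr_r (_ : (1 + (1 - Rpower y (- a)) / a) * a = a + 1 - Rpower y (- a)); last by field; lra.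
rewrite (_ : (1 + (1 - E) / a) * a = a + 1 - E); last by field; lra.
by rewrite (_ : E / x * a = E * (1 + a / x) - E); [lra | field; lra].
Qed.

Lemma sum_n_big (b : nat -> R) n : sum_n b n = \big[Rplus/0]_(0 <= k < n.+1) b k.
Proof.
elim: n => [|n IH]; first by rewrite big_nat1 sum_O.
by rewrite sum_Sn IH [RHS]big_nat_recr.
Qed.

Lemma zeta_partial_le s n : 1 < s ->
  \big[Rplus/0]_(0 <= k < n) Rpower (INR k.+1) (- s) <= zeta s.
Proof.
move=> s1; pose b k := Rpower (INR k.+1) (- s).
have inc k : sum_n b k <= sum_n b k.+1.
  by rewrite sum_Sn /plus /=; have := Rpower_gt0 (INR k.+2) (- s); rewrite -/(b k.+1); lra.
have [l hl] : ex_finite_lim_seq (sum_n b).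
  apply: (ex_finite_lim_seq_incr _ (1 + 1 / (s - 1))) => // k.
  rewrite sum_n_big; apply: Rle_trans (zeta_partial_bound k s1) _.
  apply: Rplus_le_compat_l; apply: Rmult_le_compat_r.
    by apply: Rlt_le; apply: Rinv_0_lt_compat; lra.
  by have := Rpower_gt0 (INR k.+1) (1 - s); lra.
have zl : zeta s = l by apply: is_series_unique; exact: hl.
case: n => [|n].
  rewrite big_geq // zl.
  have := is_lim_seq_incr_compare _ _ hl inc 0; rewrite sum_O.
  by have := Rpower_gt0 (INR 1) (- s); rewrite -/(b 0%N); lra.
by rewrite -sum_n_big zl; exact: is_lim_seq_incr_compare.
Qed.

Lemma zeta_ge1 s : 1 < s -> 1 <= zeta s.
Proof.
move=> s1; have := zeta_partial_le 1 s1.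
by rewrite big_nat1 /Rpower /= ln_1 Rmult_0_r exp_0.
Qed.

Lemma sum_symmetric N (G : Z -> R) :
  \big[Rplus/0]_(a < 2 * N + 1) G (Z.of_nat a - Z.of_nat N)%Z =
  G 0%Z + \big[Rplus/0]_(0 <= k < N) (G (Z.of_nat k.+1) + G (- Z.of_nat k.+1)%Z).
Proof.
rewrite -(big_mkord xpredT (fun a => G (Z.of_nat a - Z.of_nat N)%Z)).
elim: N => [|N IH].
  by rewrite big_nat1 big_geq // Rplus_0_r.
rewrite [in RHS]big_nat_recr // -Rplus_assoc -IH.
have -> : (2 * N.+1 + 1 = (2 * N + 1).+2)%N by lia.
rewrite big_nat_recl // big_nat_recr //.
have -> : (Z.of_nat (2 * N + 1).+1 - Z.of_nat N.+1 = Z.of_nat N.+1)%Z by lia.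
have -> : (Z.of_nat 0 - Z.of_nat N.+1 = - Z.of_nat N.+1)%Z by lia.
have e k : (Z.of_nat k.+1 - Z.of_nat N.+1 = Z.of_nat k - Z.of_nat N)%Z by lia.
under eq_bigr => k _ do rewrite e.
by rewrite /=; ring.
Qed.

Lemma boxpt_inj d N : injective (@boxpt d N).
Proof.
move=> g g' e; apply/ffunP => j; apply: val_inj.
by have := congr1 (fun h => h j) e; rewrite /boxpt /=; lia.
Qed.

Lemma boxpt_surj d N (h : 'I_d -> Z) : (forall j, (Z.abs (h j) <= Z.of_nat N)%Z) ->
  exists g : {ffun 'I_d -> 'I_(2 * N + 1)}, boxpt g = h.
Proof.
move=> hN.
have lt j : (Z.to_nat (h j + Z.of_nat N) < 2 * N + 1)%N by have := hN j; lia.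
exists [ffun j => Ordinal (lt j)].
apply: functional_extensionality => j; rewrite /boxpt ffunE /=.
by have := hN j; lia.
Qed.

Lemma boxsumR_mono d N M (F : ('I_d -> Z) -> R) : (forall h, 0 <= F h) -> (N <= M)%N ->
  boxsumR N F <= boxsumR M F.
Proof.
move=> F0 NM.
(* Shifting every index by [M - N] embeds the small box in the large one without changing the
   integer point. *)
have lt (g : {ffun 'I_d -> 'I_(2 * N + 1)}) j : (g j + (M - N) < 2 * M + 1)%N.
  by have := ltn_ord (g j); lia.
pose f g : {ffun 'I_d -> 'I_(2 * M + 1)} := [ffun j => Ordinal (lt g j)].
have fE g : boxpt (f g) = boxpt g.
  by apply: functional_extensionality => j; rewrite /boxpt ffunE /=; lia.
have finj : injective f by move=> g g' /(congr1 (@boxpt _ _)); rewrite !fE; apply: boxpt_inj.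
rewrite /boxsumR; under eq_bigr => g _ do rewrite -fE.
rewrite -(big_imset (fun g => F (boxpt g))) /=; last by move=> *; apply: finj.
exact: sumR_le_cond.
Qed.

(** * Korobov weights *)

Definition nontrivial d (h : 'I_d -> Z) : bool := [exists j, ~~ Z.eqb (h j) 0].

Section Weights.
Variables (d : nat) (lam alpha : R) (gamma : {fset nat} -> R).
Hypotheses (lam_gt : 1 / 2 < lam) (lam_lt : lam < alpha).
Hypothesis gammaP : forall u, 0 < gamma u <= 1.
Implicit Type h : 'I_d -> Z.

Let V := Vd d alpha lam gamma.
Let r h := rw alpha gamma h.

Lemma abs_IZR_ge1 z : ~~ Z.eqb z 0 -> 1 <= IZR (Z.abs z).
Proof. by move=> /Z.eqb_spec z0; apply: IZR_le; lia. Qed.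

Lemma exponent_gt1 : 1 < alpha / lam.
Proof. by apply: (Rmult_lt_reg_r lam); [lra | rewrite /Rdiv Rmult_assoc Rinv_l; lra]. Qed.

Lemma two_zeta_ge1 : 1 <= 2 * zeta (alpha / lam).
Proof. by have := zeta_ge1 exponent_gt1; lra. Qed.

Lemma rw_gt0 h : 0 < r h.
Proof.
apply: Rmult_lt_0_compat; first exact/Rinv_0_lt_compat/(proj1 (gammaP _)).
by apply: prodR_gt0 => j _; apply: Rpower_gt0.
Qed.

Lemma Vd_term_ge0 (u : {set 'I_d}) :
  0 <= Rpower (gamma (toFS (mem u))) (1 / lam) * (2 * zeta (alpha / lam)) ^ #|u|.
Proof.
apply: Rmult_le_pos; first exact/Rlt_le/Rpower_gt0.
by apply: pow_le; have := two_zeta_ge1; lra.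
Qed.

Lemma Rpower_rw h : Rpower (r h) (- (1 / lam)) =
  Rpower (gamma (supp h)) (1 / lam) *
  \big[Rmult/1]_(j < d | ~~ Z.eqb (h j) 0) Rpower (IZR (Z.abs (h j))) (- (alpha / lam)).
Proof.
have [g0 _] := gammaP (supp h).
rewrite /r /rw -Rpower_mult_distr; last 2 first.
- exact: Rinv_0_lt_compat.
- by apply: prodR_gt0 => j _; apply: Rpower_gt0.
congr (_ * _).
  by rewrite /Rpower ln_Rinv //; congr exp; ring.
rewrite Rpower_prod; last by move=> j _; apply: Rpower_gt0.
by apply: eq_bigr => j _; rewrite Rpower_mult; congr Rpower; field; lra.
Qed.

Lemma toFS_ext (P Q : pred 'I_d) : P =1 Q -> toFS P = toFS Q.
Proof. by move=> e; rewrite /toFS (eq_filter e). Qed.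

(** Frequencies are grouped by support [u]. For fixed [u] the sum factors over the coordinates, and
    each coordinate in [u] contributes at most [2 zeta(alpha/lam)]. *)
Lemma boxsumR_rw_le N :
  boxsumR N (fun h => if nontrivial h then Rpower (r h) (- (1 / lam)) else 0) <= V.
Proof.
pose sg (g : {ffun 'I_d -> 'I_(2 * N + 1)}) := [set j | ~~ Z.eqb (boxpt g j) 0].
have nzE g : nontrivial (boxpt g) = (sg g != set0).
  apply/existsP/set0Pn => -[j hj]; exists j; move: hj; by rewrite inE.
rewrite /boxsumR -big_mkcond (eq_bigl _ _ nzE).
rewrite (partition_big sg (fun u => u != set0)) //.
apply: sumR_le => u u0.
pose t z := Rpower (IZR (Z.abs z)) (- (alpha / lam)).
have t0 z : 0 < t z by apply: Rpower_gt0.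
(* The support condition is built into the factors: their product vanishes unless the support is
   exactly [u]. The sum may then run over the whole box, and sum and product can be exchanged. *)
pose F (j : 'I_d) (a : 'I_(2 * N + 1)) :=
  let z := (Z.of_nat a - Z.of_nat N)%Z in
  if (j \in u) then (if Z.eqb z 0 then 0 else t z) else (if Z.eqb z 0 then 1 else 0).
have F0 j a : 0 <= F j a.
  by rewrite /F; have := t0 (Z.of_nat a - Z.of_nat N)%Z; case: (_ \in _); case: Z.eqb; lra.
apply: (Rle_trans _ (\big[Rplus/0]_(g | (sg g != set0) && (sg g == u))
    (Rpower (gamma (toFS (mem u))) (1 / lam) * \big[Rmult/1]_(j < d) F j (g j)))).
  apply: Req_le; apply: eq_bigr => g /andP[_ /eqP gu].
  rewrite Rpower_rw; congr (Rpower (gamma _) _ * _).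
    by apply: toFS_ext => j; rewrite -gu /= inE.
  rewrite big_mkcond; apply: eq_bigr => j _; rewrite /F -gu inE -/(boxpt g j).
  by case: Z.eqb.
rewrite sumR_mull; apply: Rmult_le_compat_l; first exact/Rlt_le/Rpower_gt0.
apply: (Rle_trans _ (\big[Rplus/0]_(g : {ffun 'I_d -> 'I_(2 * N + 1)}) \big[Rmult/1]_(j < d) F j (g j))).
  by apply: sumR_le_cond => // g _; apply: prodR_ge0.
rewrite -(bigA_distr_bigA F).
apply: (Rle_trans _ (\big[Rmult/1]_(j < d) (if j \in u then 2 * zeta (alpha / lam) else 1))).
  apply: prodR_le => j _; split; first by apply: sumR_ge0.
  rewrite /F; case: (j \in u).
    rewrite (sum_symmetric N (fun z => if Z.eqb z 0 then 0 else t z)) /= Rplus_0_l.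
    have -> : \big[Rplus/0]_(0 <= k < N) (t (Z.pos (Pos.of_succ_nat k)) + t (Z.neg (Pos.of_succ_nat k)))
      = 2 * \big[Rplus/0]_(0 <= k < N) Rpower (INR k.+1) (- (alpha / lam)).
      rewrite -sumR_mull; apply: eq_bigr => k _.
      have ep : IZR (Z.abs (Z.pos (Pos.of_succ_nat k))) = INR k.+1 by rewrite INR_IZR_INZ.
      by rewrite /t !ep; ring.
    by apply: Rmult_le_compat_l; [lra | exact/zeta_partial_le/exponent_gt1].
  rewrite (sum_symmetric N (fun z => if Z.eqb z 0 then 1 else 0)) /=.
  by rewrite big1 ?Rplus_0_r => [|i _]; lra.
rewrite -big_mkcond big_const; apply: Req_le.
by elim: #|u| => //= m ->.
Qed.

(** The term of [V] indexed by the support of [h] alone is large enough, because [2 zeta >= 1]. *)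
Lemma Rpower_gamma_le_Vd h : nontrivial h -> Rpower (gamma (supp h)) (1 / lam) <= V.
Proof.
move=> /existsP[j hj].
set u := [set j | ~~ Z.eqb (h j) 0].
have u0 : u != set0 by apply/set0Pn; exists j; rewrite inE.
have -> : supp h = toFS (mem u) by apply: toFS_ext => i; rewrite /= inE.
rewrite /V /Vd (bigD1 u) //=.
set S := \big[_/_]_(_ | _) _.
have S0 : 0 <= S by apply: sumR_ge0 => v _; exact: Vd_term_ge0.
have : 1 <= (2 * zeta (alpha / lam)) ^ #|u| by apply: pow_R1_Rle; exact: two_zeta_ge1.
move=> p1; rewrite -[X in X <= _]Rplus_0_r; apply: Rplus_le_compat => //.
rewrite -[X in X <= _]Rmult_1_r; apply: Rmult_le_compat_l => //.
exact/Rlt_le/Rpower_gt0.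
Qed.

Lemma Vd_gt0 : (0 < d)%N -> 0 < V.
Proof.
move=> d0; apply: Rlt_le_trans (Rpower_gt0 _ _) (@Rpower_gamma_le_Vd (fun _ => 1%Z) _).
by apply/existsP; exists (Ordinal d0).
Qed.

Lemma gamma_le_Vd h : nontrivial h -> gamma (supp h) <= Rpower V lam.
Proof.
move=> hn; have [g0 _] := gammaP (supp h).
have : Rpower (Rpower (gamma (supp h)) (1 / lam)) lam <= Rpower V lam.
  apply: Rle_Rpower_l; first lra; split; first exact: Rpower_gt0.
  exact: Rpower_gamma_le_Vd.
by rewrite Rpower_mult (_ : 1 / lam * lam = 1) ?Rpower_1 //; field; lra.
Qed.

(** All other factors [|h_i|^alpha] in the weight are at least 1. *)
Lemma coord_le_rw h j : ~~ Z.eqb (h j) 0 ->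
  Rpower (IZR (Z.abs (h j))) alpha <= gamma (supp h) * r h.
Proof.
move=> hj; have [g0 _] := gammaP (supp h).
rewrite /r /rw -Rmult_assoc Rinv_r ?Rmult_1_l; last lra.
rewrite (bigD1 j) //= -[X in X <= _]Rmult_1_r.
apply: Rmult_le_compat_l; first exact/Rlt_le/Rpower_gt0.
apply: (Rle_trans _ (\big[Rmult/1]_(i < d | ~~ Z.eqb (h i) 0 && (i != j)) 1)).
  by rewrite big1 //; lra.
apply: prodR_le => i /andP[hi _]; split; first lra.
rewrite -(Rpower_O (IZR (Z.abs (h i)))); last by have := abs_IZR_ge1 hi; lra.
by apply: Rle_Rpower; [exact: abs_IZR_ge1 | lra].
Qed.

Lemma coord_le_Vd_rw h j : ~~ Z.eqb (h j) 0 ->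
  Rpower (IZR (Z.abs (h j))) alpha <= Rpower V lam * r h.
Proof.
move=> hj; apply: Rle_trans (coord_le_rw hj) _.
apply: Rmult_le_compat_r; first exact/Rlt_le/rw_gt0.
by apply: gamma_le_Vd; apply/existsP; exists j.
Qed.

Lemma coord_le_rw1 h j : ~~ Z.eqb (h j) 0 ->
  Rpower (IZR (Z.abs (h j))) alpha <= r h.
Proof.
move=> hj; apply: Rle_trans (coord_le_rw hj) _.
by have [_ g1] := gammaP (supp h); have := rw_gt0 h; nra.
Qed.

End Weights.

(** * Divisibility, duality and counting *)

(** * Random draws and dual vectors *)

HB.instance Definition _ :=
  Monoid.isComLaw.Build Z 0%Z Z.add Z.add_assoc Z.add_comm Z.add_0_l.

Definition dotZ d (h : 'I_d -> Z) (z : 'I_d -> nat) : Z :=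
  \big[Z.add/0%Z]_(j < d) (h j * Z.of_nat (z j))%Z.

Definition dual d (x : nat * ('I_d -> nat)) (h : 'I_d -> Z) : bool :=
  (x.1 %| Z.abs_nat (dotZ h x.2))%N.

Definition shift_ord d m (w : {ffun 'I_d -> 'I_m}) : 'I_d -> nat := fun j => (w j).+1.

Lemma dvdn_absP p a : reflect (Z.divide (Z.of_nat p) a) (p %| Z.abs_nat a)%N.
Proof.
apply: (iffP idP) => [/dvdnP[k e]|[k e]].
  by apply/Z.divide_abs_r; exists (Z.of_nat k); lia.
by apply/dvdnP; exists (Z.abs_nat k); rewrite e Zabs2Nat.inj_mul; lia.
Qed.

(** Once the other coordinates are fixed, at most one value of coordinate [j0] makes [h.z] vanish
    modulo [p], because [h_j0] is invertible there. *)
Lemma card_dual d p (h : 'I_d -> Z) (j0 : 'I_d) : prime p -> ~~ (p %| Z.abs_nat (h j0))%N ->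
  (#|[set w : {ffun 'I_d -> 'I_p.-1} | dual (p, shift_ord w) h]| * p.-1 <= p.-1 ^ d)%N.
Proof.
move=> pp pN; set S := [set w | _].
(* Overwriting coordinate [j0] by an arbitrary value is injective on pairs with a dual first
   component; the cardinality bound follows. *)
pose f (x : {ffun 'I_d -> 'I_p.-1} * 'I_p.-1) : {ffun 'I_d -> 'I_p.-1} :=
  [ffun j => if j == j0 then x.2 else x.1 j].
have finj : {in setX S setT &, injective f}.
  move=> [w1 t1] [w2 t2]; rewrite !inE /= !andbT => d1 d2 e.
  have et : t1 = t2 by move/ffunP/(_ j0): e; rewrite !ffunE eqxx.
  have ew j : j != j0 -> w1 j = w2 j by move=> /negbTE jj; move/ffunP/(_ j): e; rewrite !ffunE jj.
  rewrite et; congr (_, _); apply/ffunP => j; case: (eqVneq j j0) => [->|]; last exact: ew.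
  move: d1 d2 => /dvdn_absP[k1 e1] /dvdn_absP[k2 e2].
  rewrite /dotZ /= (bigD1 j0) //= in e1; rewrite /dotZ /= (bigD1 j0) //= in e2.
  rewrite (eq_bigr (fun j => (h j * Z.of_nat (shift_ord w2 j))%Z)) in e1; last first.
    by move=> i ij; rewrite /shift_ord ew.
  set D := \big[_/_]_(_ | _) _ in e1 e2.
  have : (p %| Z.abs_nat (h j0 * (Z.of_nat (w1 j0) - Z.of_nat (w2 j0))))%N.
    apply/dvdn_absP; exists (k1 - k2)%Z; rewrite Z.mul_sub_distr_r -e1 -e2 !Zpos_P_of_succ_nat.
    by clear e1 e2; move: D (h j0) (Z.of_nat _) (Z.of_nat _) => D0 a b c; ring.
  rewrite Zabs2Nat.inj_mul Euclid_dvdM // (negbTE pN) /= => /dvdnP[k ek].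
  apply: val_inj; have b1 := ltn_ord (w1 j0); have b2 := ltn_ord (w2 j0).
  move: ek b1 b2; rewrite /=; move: (nat_of_ord (w1 j0)) (nat_of_ord (w2 j0)) => a b ek b1 b2.
  case: k ek => [|k] ek; first by lia.
  by exfalso; move: ek; rewrite mulSn; lia.
have := card_in_imset finj; rewrite cardsX cardsT card_ord => e.
rewrite -e; apply: leq_trans (max_card _) _.
by rewrite card_ffun !card_ord.
Qed.

(** The product of the primes of [s] dividing [m] divides [m], and each of them is at least 2. *)
Lemma expn2_count_dvdn (s : seq nat) m : uniq s -> all prime s -> (0 < m)%N ->
  (2 ^ count (fun p => p %| m)%N s <= m)%N.
Proof.
move=> us ps m0.
set t := [seq p <- s | (p %| m)%N].
apply: (@leq_trans (\prod_(p <- t) p)).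
  have tp : all prime t by rewrite all_filter; apply: sub_all ps => p pp; apply/implyP.
  rewrite -size_filter -/t; elim: t tp => [|p t IH] /=; first by rewrite big_nil.
  by move=> /andP[pp tp]; rewrite big_cons expnS leq_mul ?prime_gt1 // IH.
apply: dvdn_leq => //; apply: prod_primes_dvdn; first exact: filter_uniq.
- by rewrite all_filter; apply: sub_all ps => p pp; apply/implyP.
- exact: filter_all.
Qed.

(** The window starts one above the rounded-up half, so already [p - 1] is at least [n/2]; the
    collision probability [1/(p-1)] is then at most [2/n]. *)
Lemma mem_primesP n p : p \in primesP n -> prime p /\ INR n / 2 <= INR p.-1.
Proof.
rewrite mem_filter mem_iota => /andP[pp /andP[lp _]]; split => //.
have : INR n <= INR (p.-1 + p.-1).
  apply: INR_leq; have := odd_double_half n; have := uphalf_half n; lia.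
by rewrite plus_INR; lra.
Qed.

(** * Expectation over the draws *)

Section Expectation.
Variables (d n : nat).
Hypothesis P_neq0 : primesP n <> [::].
Implicit Types (phi psi : nat * ('I_d -> nat) -> R) (g : seq (nat * ('I_d -> nat)) -> R).

(** One layer of the recursion [Edraws], so that [EdrawsS] holds by computation. *)
Definition Edraw phi : R :=
  / INR (size (primesP n)) *
  \big[Rplus/0]_(p <- primesP n)
    (/ INR (p.-1 ^ d) *
     \big[Rplus/0]_(w : {ffun 'I_d -> 'I_(p.-1)}) phi (p, shift_ord w)).

Lemma EdrawsS k g : Edraws n k.+1 g = Edraw (fun x => Edraws n k (fun l => g (x :: l))).
Proof. by []. Qed.

Lemma size_primesP_gt0 : 0 < INR (size (primesP n)).
Proof. by case: (primesP n) P_neq0 => // p l _; apply: lt_0_INR => /=; lia. Qed.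

Lemma grid_gt0 p : p \in primesP n -> 0 < INR (p.-1 ^ d).
Proof.
move=> /mem_primesP[pp _]; apply: lt_0_INR; apply/ltP.
by rewrite expn_gt0; have := prime_gt1 pp; lia.
Qed.

Lemma Edraw_le phi psi : (forall x, x.1 \in primesP n -> phi x <= psi x) ->
  Edraw phi <= Edraw psi.
Proof.
move=> h; apply: Rmult_le_compat_l; first exact/Rlt_le/Rinv_0_lt_compat/size_primesP_gt0.
rewrite big_seq_cond [X in _ <= X]big_seq_cond; apply: sumR_le => p /andP[pP _].
apply: Rmult_le_compat_l; first exact/Rlt_le/Rinv_0_lt_compat/grid_gt0.
by apply: sumR_le => w _; apply: h.
Qed.

Lemma Edraw_ext phi psi : (forall x, phi x = psi x) -> Edraw phi = Edraw psi.
Proof. by move=> h; rewrite (_ : phi = psi) //; apply: functional_extensionality. Qed.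

Lemma EdrawD phi psi : Edraw (fun x => phi x + psi x) = Edraw phi + Edraw psi.
Proof.
rewrite /Edraw -Rmult_plus_distr_l; congr (_ * _); rewrite -big_split.
by apply: eq_bigr => p _; rewrite big_split Rmult_plus_distr_l.
Qed.

Lemma EdrawZ c phi : Edraw (fun x => c * phi x) = c * Edraw phi.
Proof.
rewrite /Edraw -Rmult_assoc [c * _]Rmult_comm Rmult_assoc; congr (_ * _).
rewrite -sumR_mull; apply: eq_bigr => p _.
by rewrite sumR_mull -!Rmult_assoc [c * _]Rmult_comm.
Qed.

Lemma Edraw_const c : Edraw (fun=> c) = c.
Proof.
rewrite /Edraw (eq_big_seq (fun=> c)).
  rewrite sumR_const count_predT -Rmult_assoc Rinv_l ?Rmult_1_l //.
  by have := size_primesP_gt0; lra.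
move=> p pP; rewrite sumR_const.
have -> : count predT (index_enum {ffun 'I_d -> 'I_p.-1}) = (p.-1 ^ d)%N.
  by rewrite -sum1_count sum1_card card_ffun !card_ord.
by have := grid_gt0 pP => g0; rewrite -Rmult_assoc Rinv_l ?Rmult_1_l //; lra.
Qed.

Lemma Edraw_sum (I : Type) (r : seq I) (P : pred I) (phi : I -> nat * ('I_d -> nat) -> R) :
  Edraw (fun x => \big[Rplus/0]_(i <- r | P i) phi i x) =
  \big[Rplus/0]_(i <- r | P i) Edraw (phi i).
Proof.
elim: r => [|i r IH].
  by rewrite big_nil -[RHS](Edraw_const 0); apply: Edraw_ext => x; rewrite big_nil.
rewrite big_cons; case: ifP => Pi; last first.
  by rewrite -IH; apply: Edraw_ext => x; rewrite big_cons Pi.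
by rewrite -IH -EdrawD; apply: Edraw_ext => x; rewrite big_cons Pi.
Qed.

Lemma Edraws_le k g g' :
  (forall l, size l = k -> (forall i, (i < k)%N -> (nth (0%N, fun=> 0%N) l i).1 \in primesP n) ->
     g l <= g' l) ->
  Edraws n k g <= Edraws n k g'.
Proof.
elim: k g g' => [|k IH] g g' h; first by apply: h.
rewrite !EdrawsS; apply: Edraw_le => x xP; apply: IH => l sl lP.
by apply: h => [|[|i] ik] /=; [rewrite sl | | exact: lP].
Qed.

Lemma Edraws_ext k g g' : (forall l, g l = g' l) -> Edraws n k g = Edraws n k g'.
Proof. by move=> h; rewrite (_ : g = g') //; apply: functional_extensionality. Qed.

Lemma Edraws_const k c : @Edraws d n k (fun=> c) = c.
Proof.
elim: k => // k IH; rewrite EdrawsS -[RHS]Edraw_const; exact: Edraw_ext.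
Qed.

Lemma EdrawsD k g g' : Edraws n k (fun l => g l + g' l) = Edraws n k g + Edraws n k g'.
Proof.
elim: k g g' => // k IH g g'.
by rewrite !EdrawsS -EdrawD; apply: Edraw_ext => x; rewrite IH.
Qed.

Lemma EdrawsZ k c g : Edraws n k (fun l => c * g l) = c * Edraws n k g.
Proof.
elim: k g => // k IH g.
by rewrite !EdrawsS -EdrawZ; apply: Edraw_ext => x; rewrite IH.
Qed.

Lemma Edraws_sum k phi :
  Edraws n k (fun l => \big[Rplus/0]_(x <- l) phi x) = INR k * Edraw phi.
Proof.
elim: k => [|k IH]; first by rewrite /= big_nil Rmult_0_l.
rewrite EdrawsS S_INR Rmult_plus_distr_r Rmult_1_l Rplus_comm -IH -[X in _ + X]Edraw_const -EdrawD.
apply: Edraw_ext => x; rewrite -[phi x](Edraws_const k) -EdrawsD.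
by apply: Edraws_ext => l; rewrite big_cons.
Qed.

(** Independence of the draws. It evaluates the exponential moment of the number of bad draws. *)
Lemma Edraws_prod k phi :
  Edraws n k (fun l => \big[Rmult/1]_(x <- l) phi x) = Edraw phi ^ k.
Proof.
elim: k => [|k IH]; first by rewrite /= big_nil.
rewrite EdrawsS /= -IH Rmult_comm -EdrawZ.
apply: Edraw_ext => x; rewrite Rmult_comm -EdrawsZ.
by apply: Edraws_ext => l; rewrite big_cons.
Qed.

(** Conditionally on [p]: if [p] does not divide [h_j], the fraction of dual vectors is at most
    [1/(p-1) <= 2/n]; otherwise it is bounded by 1, and the second term counts these primes. *)
Lemma Edraw_dual_le (h : 'I_d -> Z) (j : 'I_d) : (0 < n)%N ->
  Edraw (fun x => if dual x h then 1 else 0) <=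
  2 / INR n + INR (count (fun p => p %| Z.abs_nat (h j))%N (primesP n)) / INR (size (primesP n)).
Proof.
move=> n0; have n0R : 0 < INR n by apply: lt_0_INR; lia.
set P := primesP n; have s0 := size_primesP_gt0; rewrite -/P in s0.
apply: (Rle_trans _ (/ INR (size P) * \big[Rplus/0]_(p <- P)
    (2 / INR n + (if (p %| Z.abs_nat (h j))%N then 1 else 0)))); last first.
  rewrite big_split /= -(big_mkcond (fun p => p %| Z.abs_nat (h j))%N) /=.
  by rewrite !sumR_const count_predT; apply: Req_le; field; lra.
apply: Rmult_le_compat_l; first exact/Rlt_le/Rinv_0_lt_compat.
rewrite big_seq_cond [X in _ <= X]big_seq_cond; apply: sumR_le => p /andP[pP _].
have [pp pn] := mem_primesP pP.
have g0 := grid_gt0 pP.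
have cE : \big[Rplus/0]_(w : {ffun 'I_d -> 'I_p.-1}) (if dual (p, shift_ord w) h then 1 else 0)
   = INR #|[set w : {ffun 'I_d -> 'I_p.-1} | dual (p, shift_ord w) h]|.
  rewrite -big_mkcond sumR_const Rmult_1_r; congr INR.
  by rewrite -sum1_count sum1dep_card.
rewrite cE; set S := #|_|.
case: ifP => [_|/negbT pN].
  have : 0 < 2 / INR n by apply: Rdiv_lt_0_compat; lra.
  have : INR S <= INR (p.-1 ^ d).
    apply: INR_leq; apply: leq_trans (max_card _) _; by rewrite card_ffun !card_ord.
  move=> h1 h2; have : / INR (p.-1 ^ d) * INR S <= 1.
    apply: (Rmult_le_reg_l (INR (p.-1 ^ d))) => //.
    by rewrite -Rmult_assoc Rinv_r ?Rmult_1_l ?Rmult_1_r; lra.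
  by lra.
have := INR_leq (card_dual pp pN); rewrite mult_INR -/S => SP.
rewrite Rplus_0_r.
apply: (Rmult_le_reg_l (INR (p.-1 ^ d))) => //.
rewrite -Rmult_assoc Rinv_r ?Rmult_1_l; last lra.
apply: (Rmult_le_reg_r (INR p.-1)); first lra.
apply: Rle_trans SP _; rewrite Rmult_assoc -[X in X <= _]Rmult_1_r.
apply: Rmult_le_compat_l; first lra.
rewrite (_ : 1 = 2 / INR n * (INR n / 2)); last by field; lra.
by apply: Rmult_le_compat_l => //; apply: Rlt_le; apply: Rdiv_lt_0_compat; lra.
Qed.

End Expectation.

(** * The median *)

Lemma RlebP x y : reflect (x <= y) (Rleb x y).
Proof. by rewrite /Rleb; case: Rle_dec => h; constructor. Qed.

Lemma Rleb_total : total Rleb.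
Proof. by move=> x y; apply/orP; case: (Rle_lt_dec x y) => h; [left|right]; apply/RlebP; lra. Qed.

Lemma Rleb_trans : transitive Rleb.
Proof. by move=> y x z /RlebP xy /RlebP yz; apply/RlebP; lra. Qed.

Lemma Rleb_refl : reflexive Rleb.
Proof. by move=> x; apply/RlebP; lra. Qed.

(* All values on the far side of the median from [a] are at least as far from [a] as the median. *)
Lemma count_median (s : seq R) T a : size s = (2 * T + 1)%N ->
  (T < count (fun x => Rleb (Rabs (medianR s - a)) (Rabs (x - a))) s)%N.
Proof.
move=> ss; set p := fun x => _.
rewrite -(count_sort Rleb) -(cat_take_drop T (sort Rleb s)) count_cat.
rewrite /p /medianR ss (_ : (2 * T + 1)./2 = T); last by lia.
set s' := sort Rleb s; have ss' : size s' = (2 * T + 1)%N by rewrite size_sort.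
have srt : sorted Rleb s' by apply: sort_sorted; exact: Rleb_total.
have mono i j : (i <= j)%N -> (j < 2 * T + 1)%N -> nth 0 s' i <= nth 0 s' j.
  move=> ij jT; apply/RlebP; apply: (sorted_leq_nth Rleb_trans Rleb_refl) => //;
    rewrite inE ss'; lia.
set m := nth 0 s' T; pose q x := Rleb (Rabs (m - a)) (Rabs (x - a)); rewrite -/q.
have [am|ma] := Rle_lt_dec a m.
  have : all q (drop T s').
    apply/(all_nthP 0) => i; rewrite size_drop ss' nth_drop => iT.
    have := mono T (T + i)%N ltac:(lia) ltac:(lia); rewrite -/m => h.
    by apply/RlebP; rewrite !Rabs_pos_eq; lra.
  by rewrite all_count size_drop ss' => /eqP ->; lia.
have : all q (take T.+1 s').
  apply/(all_nthP 0) => i; rewrite size_take ss' => iT.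
  rewrite nth_take; last by move: iT; case: ifP; lia.
  have := mono i T ltac:(move: iT; case: ifP; lia) ltac:(lia); rewrite -/m => h.
  by apply/RlebP; rewrite !Rabs_left; lra.
rewrite all_count size_take ss' => /eqP e; rewrite -count_cat cat_take_drop.
rewrite -(cat_take_drop T.+1 s') count_cat e; case: ifP; lia.
Qed.

Section MedianError.
Context {X : Type} (x0 : X).
Implicit Types (l : seq X) (good : pred X).

(** At least [T + 1] samples are as far from [a] as the median and at most [T/2] samples are bad, so
    at least [(T + 1)/2] good samples have [e] no smaller than the median's error. *)
Lemma median_error_good l T (v e : X -> R) good a :
  size l = (2 * T + 1)%N -> (forall x, Rabs (v x - a) <= e x) ->
  (2 * count (predC good) l <= T)%N ->
  Rabs (medianR (map v l) - a) * INR T.+1 <= 2 * \big[Rplus/0]_(x <- l | good x) e x.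
Proof.
move=> sl ve bad.
have := @count_median (map v l) T a; rewrite size_map count_map => /(_ sl).
set D := Rabs (_ - a); set P := preim v _ => cP.
have D0 : 0 <= D by apply: Rabs_pos.
have cPg : (count P l <= count (predI P good) l + count (predC good) l)%N.
  by elim: (l) => //= x l' IH; case: (P x); case: (good x) => /=; lia.
have : INR T.+1 <= 2 * INR (count (predI P good) l).
  rewrite -[2]/(INR 2) -mult_INR; apply: INR_leq; lia.
have e0 x : 0 <= e x by apply: Rle_trans (Rabs_pos _) (ve x).
have : \big[Rplus/0]_(x <- l | predI P good x) D <= \big[Rplus/0]_(x <- l | good x) e x.
  apply: Rle_trans (_ : \big[Rplus/0]_(x <- l | predI P good x) e x <= _).
    apply: sumR_le => x /andP[/RlebP h _]; exact: Rle_trans h (ve x).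
  by apply: sumR_le_cond => // x /andP[].
rewrite sumR_const; nra.
Qed.

Lemma median_error_le l T (v : X -> R) a W : size l = (2 * T + 1)%N ->
  (forall i, (i < size l)%N -> Rabs (v (nth x0 l i) - a) <= W) ->
  Rabs (medianR (map v l) - a) <= W.
Proof.
move=> sl h; have := @count_median (map v l) T a; rewrite size_map count_map => /(_ sl).
move=> c; have : has (preim v (fun x => Rleb (Rabs (medianR (map v l) - a)) (Rabs (x - a)))) l.
  by rewrite has_count; lia.
move=> /(has_nthP x0)[i il /RlebP hi]; exact: Rle_trans hi (h i il).
Qed.

(* If more than [T/2] elements are bad, then [64 ^ #bad = 8 ^ (2 #bad) >= 8 ^ (T + 1)], so the
   second summand dominates [W]. *)
Lemma median_error l T (v e : X -> R) good a W :
  size l = (2 * T + 1)%N -> (forall x, Rabs (v x - a) <= e x) -> 0 <= W ->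
  (forall i, (i < size l)%N -> e (nth x0 l i) <= W) ->
  Rabs (medianR (map v l) - a) <=
    2 / INR T.+1 * \big[Rplus/0]_(x <- l) (if good x then e x else 0) +
    W / 8 ^ T.+1 * \big[Rmult/1]_(x <- l) (if good x then 1 else 64).
Proof.
move=> sl ve W0 eW.
have T0 : 0 < INR T.+1 by apply: lt_0_INR; lia.
have e0 x : 0 <= e x by apply: Rle_trans (Rabs_pos _) (ve x).
have p8 k : 0 < 8 ^ k by apply: pow_lt; lra.
have sum0 : 0 <= \big[Rplus/0]_(x <- l) (if good x then e x else 0).
  by apply: sumR_ge0 => x _; case: ifP => _ //; lra.
have prodE : \big[Rmult/1]_(x <- l) (if good x then 1 else 64) = 8 ^ (2 * count (predC good) l).
  rewrite pow_mult (_ : 8 ^ 2 = 64); last by lra.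
  elim: (l) => [|x l' IH]; first by rewrite big_nil.
  by rewrite big_cons IH /=; case: (good x) => /=; rewrite ?Rmult_1_l.
rewrite prodE; case: (leqP (2 * count (predC good) l) T) => [bad|bad].
  have := median_error_good sl ve bad; rewrite big_mkcond => h.
  have : 0 <= W / 8 ^ T.+1 * 8 ^ (2 * count (predC good) l).
    apply: Rmult_le_pos; last exact: Rlt_le.
    by apply: Rmult_le_pos => //; exact/Rlt_le/Rinv_0_lt_compat.
  have : Rabs (medianR (map v l) - a) <=
      2 / INR T.+1 * \big[Rplus/0]_(x <- l) (if good x then e x else 0).
    apply: (Rmult_le_reg_r (INR T.+1)) => //; apply: Rle_trans h _.
    by set S := \big[_/_]_(_ <- _) _; apply: Req_le; field; lra.
  by lra.
have h1 : Rabs (medianR (map v l) - a) <= W.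
  apply: (@median_error_le _ T) => // i il; exact: Rle_trans (ve _) (eW i il).
have h2 : 0 <= 2 / INR T.+1 * \big[Rplus/0]_(x <- l) (if good x then e x else 0).
  by apply: Rmult_le_pos => //; apply: Rlt_le; apply: Rdiv_lt_0_compat; lra.
have h3 : W <= W / 8 ^ T.+1 * 8 ^ (2 * count (predC good) l).
  rewrite /Rdiv Rmult_assoc -[X in X <= _]Rmult_1_r; apply: Rmult_le_compat_l => //.
  rewrite -(Rinv_l (8 ^ T.+1)); last by have := p8 T.+1; lra.
  apply: Rmult_le_compat_l; first exact/Rlt_le/Rinv_0_lt_compat.
  by apply: Rle_pow; [lra | lia].
lra.
Qed.

Lemma Cmod_le_Rabs (z : C) : Cmod z <= Rabs (Re z) + Rabs (Im z).
Proof.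
case: z => x y /=.
have -> : (x, y) = Cplus (x, 0) (0, y) by rewrite /Cplus /= Rplus_0_r Rplus_0_l.
apply: Rle_trans (Cmod_triangle _ _) _.
have -> : Cmod (0, y) = Rabs y.
  by rewrite /Cmod /= -sqrt_Rsqr_abs /Rsqr; congr sqrt; ring.
by have := Cmod_R x; rewrite /RtoC => ->; lra.
Qed.

(** The real bound is applied to real and imaginary parts separately, which doubles both
    constants. *)
Lemma medianC_error l T (v : X -> C) good (a : C) W :
  size l = (2 * T + 1)%N -> 0 <= W ->
  (forall i, (i < size l)%N -> Cmod (Cminus a (v (nth x0 l i))) <= W) ->
  Cmod (Cminus a (medianC (map v l))) <=
    4 / INR T.+1 * \big[Rplus/0]_(x <- l) (if good x then Cmod (Cminus a (v x)) else 0) +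
    2 * W / 8 ^ T.+1 * \big[Rmult/1]_(x <- l) (if good x then 1 else 64).
Proof.
move=> sl W0 eW.
pose e x := Cmod (Cminus a (v x)).
have hr x : Rabs (Re (v x) - Re a) <= e x.
  by rewrite Rabs_minus_sym; exact: Rle_trans (Rmax_l _ _) (Rmax_Cmod (Cminus a (v x))).
have hi x : Rabs (Im (v x) - Im a) <= e x.
  by rewrite Rabs_minus_sym; exact: Rle_trans (Rmax_r _ _) (Rmax_Cmod (Cminus a (v x))).
have er := median_error good sl hr W0 eW.
have ei := median_error good sl hi W0 eW.
apply: Rle_trans (Cmod_le_Rabs _) _.
rewrite /medianC -!map_comp.
rewrite [Re _]/= [Im _]/= -/(Rminus _ _) -/(Rminus _ _) Rabs_minus_sym [X in _ + X]Rabs_minus_sym.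
move: er ei; rewrite /e -/(Re a) -/(Im a) /comp.
set A := \big[Rplus/0]_(_ <- _) _; set B := \big[Rmult/1]_(_ <- _) _.
move=> er ei; apply: Rle_trans (Rplus_le_compat _ _ _ _ er ei) _.
by apply: Req_le; rewrite /Rdiv; ring.
Qed.

End MedianError.

(** * The error of a lattice rule *)

Lemma e2piD a b : e2pi (a + b) = Cmult (e2pi a) (e2pi b).
Proof.
rewrite /e2pi /Cmult /= Rmult_plus_distr_l cos_plus sin_plus.
by congr (_, _); ring.
Qed.

Lemma e2pi0 : e2pi 0 = RtoC 1.
Proof. by rewrite /e2pi Rmult_0_r cos_0 sin_0. Qed.

Lemma e2pi_IZR m : e2pi (IZR m) = RtoC 1.
Proof.
have e1 : e2pi 1 = RtoC 1 by rewrite /e2pi Rmult_1_r cos_2PI sin_2PI.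
have pos k : e2pi (INR k) = RtoC 1.
  elim: k => [|k IH]; first exact: e2pi0.
  by rewrite S_INR e2piD IH e1 Cmult_1_l.
case: (Z_le_gt_dec 0 m) => m0.
  by rewrite -(Z2Nat.id m) // -INR_IZR_INZ.
have := pos (Z.to_nat (- m)); rewrite INR_IZR_INZ Z2Nat.id; last by lia.
move=> e; have := e2piD (IZR m) (IZR (- m)).
by rewrite -plus_IZR Z.add_opp_diag_r e e2pi0 Cmult_1_r => <-.
Qed.

Lemma e2pi_eq1 t : e2pi t = RtoC 1 -> exists m, t = IZR m.
Proof.
move=> /(congr1 fst) /= c1.
have s0 : sin (PI * t) = 0.
  have := cos_2a_sin (PI * t); rewrite -Rmult_assoc c1 => h.
  by apply: Rsqr_0_uniq; rewrite /Rsqr; lra.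
have [m hm] := sin_eq_0_0 _ s0; exists m.
by apply: (Rmult_eq_reg_l PI); [rewrite hm; ring | have := PI_RGT_0; lra].
Qed.

(** The geometric sum in product form, valid also for ratio 1. *)
Lemma geometric_e2pi t n :
  Cmult (Cminus (e2pi t) (RtoC 1)) (\big[Cplus/RtoC 0]_(k < n) e2pi (INR k * t)) =
  Cminus (e2pi (INR n * t)) (RtoC 1).
Proof.
elim: n => [|n IH].
  by rewrite big_ord0 /= Rmult_0_l e2pi0 Cmult_0_r /Cminus Cplus_opp_r.
rewrite S_INR big_ord_recr /= Cmult_plus_distr_l IH.
rewrite (_ : (INR n + 1) * t = INR n * t + t); last by ring.
by rewrite e2piD; ring.
Qed.

Lemma sumC_const n (c : C) : \big[Cplus/RtoC 0]_(k < n) c = Cmult (RtoC (INR n)) c.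
Proof.
elim: n => [|n IH]; first by rewrite big_ord0 /= Cmult_0_l.
by rewrite S_INR big_ord_recr /= IH RtoC_plus; ring.
Qed.

Lemma dotZR_frac d p (h : 'I_d -> Z) (z : 'I_d -> nat) k : (0 < p)%N ->
  exists m, dotZR h (fun j => frac_part (INR k * INR (z j) / INR p)) =
    INR k * (IZR (dotZ h z) / INR p) + IZR m.
Proof.
move=> p0; have pR : 0 < INR p by apply: lt_0_INR; lia.
exists (\big[Z.add/0%Z]_(j < d) (- (h j * Int_part (INR k * INR (z j) / INR p)))%Z).
rewrite /dotZR /dotZ !(big_morph IZR plus_IZR (erefl : IZR 0 = 0)) /Rdiv.
rewrite [_ * / _]Rmult_comm -Rmult_assoc -sumR_mull -big_split /=.
apply: eq_bigr => j _.
by rewrite /frac_part opp_IZR !mult_IZR -INR_IZR_INZ /Rdiv; ring.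
Qed.

(** Character orthogonality. Fractional parts change the phase only by integers. For dual [h] every
    summand is 1; otherwise the sum is geometric with a ratio different from 1 whose [p]-th power is
    1. *)
Lemma lattice_e2pi d p (h : 'I_d -> Z) (z : 'I_d -> nat) : (0 < p)%N ->
  Cmult (RtoC (/ INR p)) (\big[Cplus/RtoC 0]_(k < p)
     e2pi (dotZR h (fun j => frac_part (INR k * INR (z j) / INR p)))) =
  if dual (p, z) h then RtoC 1 else RtoC 0.
Proof.
move=> p0; have pR : 0 < INR p by apply: lt_0_INR; lia.
set t := IZR (dotZ h z) / INR p.
rewrite (eq_bigr (fun k : 'I_p => e2pi (INR k * t))); last first.
  by move=> k _; have [m ->] := dotZR_frac h z k p0; rewrite e2piD e2pi_IZR Cmult_1_r.
case: ifP => [/dvdn_absP[q /= eq]|ndiv].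
  rewrite (eq_bigr (fun=> RtoC 1)); last first.
    move=> k _; rewrite /t eq mult_IZR -INR_IZR_INZ.
    rewrite (_ : INR k * _ = IZR (Z.of_nat k * q)) ?e2pi_IZR //.
    by rewrite mult_IZR -INR_IZR_INZ; field; lra.
  by rewrite sumC_const Cmult_1_r -RtoC_mult Rinv_l //; lra.
have t1 : Cminus (e2pi t) (RtoC 1) <> RtoC 0.
  move=> e; have [|m em] := @e2pi_eq1 t.
    have h' : e2pi t = Cplus (Cminus (e2pi t) (RtoC 1)) (RtoC 1) by ring.
    by rewrite h' e Cplus_0_l.
  move/negP: ndiv; apply; apply/dvdn_absP; exists m; apply: eq_IZR.
  by rewrite mult_IZR -INR_IZR_INZ -em /t /=; field; lra.
have := geometric_e2pi t p.
rewrite (_ : INR p * t = IZR (dotZ h z)); last by rewrite /t; field; lra.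
rewrite e2pi_IZR {2}/Cminus Cplus_opp_r => g0.
have -> : \big[Cplus/RtoC 0]_(k < p) e2pi (INR k * t) = RtoC 0.
  set G := \big[_/_]_(_ < _) _ in g0 *.
  by rewrite -[LHS]Cmult_1_l -(Cinv_l _ t1) -Cmult_assoc g0 Cmult_0_r.
exact: Cmult_0_r.
Qed.

Lemma filterlim_sumC (I : Type) (r : seq I) (u : I -> nat -> C) (l : I -> C) :
  (forall i, filterlim (u i) eventually (locally (l i))) ->
  filterlim (fun N => \big[Cplus/RtoC 0]_(i <- r) u i N) eventually
    (locally (\big[Cplus/RtoC 0]_(i <- r) l i)).
Proof.
move=> h; elim: r => [|i r IH].
  rewrite big_nil; apply: (filterlim_ext (fun=> RtoC 0)); last exact: filterlim_const.
  by move=> N; rewrite big_nil.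
rewrite big_cons; apply: (filterlim_ext (fun N => Cplus (u i N) (\big[Cplus/RtoC 0]_(i <- r) u i N))).
  by move=> N; rewrite big_cons.
apply: filterlim_comp_2 (h i) IH _.
exact: (@filterlim_plus C_AbsRing C_NormedModule).
Qed.

Definition dualsum d (c : ('I_d -> Z) -> C) (x : nat * ('I_d -> nat)) N : C :=
  boxsumC N (fun h => if dual x h then c h else RtoC 0).

(** The Fourier series converges at each of the [p] nodes, which lie in the unit cube. Averaging the
    partial sums over the nodes keeps exactly the dual frequencies. *)
Lemma latticeRule_lim d (f : ('I_d -> R) -> C) (c : ('I_d -> Z) -> C) p z : (0 < p)%N ->
  (forall x : 'I_d -> R, (forall j, 0 <= x j <= 1) ->
     filterlim (fun N => boxsumC N (fun h => Cmult (c h) (e2pi (dotZR h x))))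
       eventually (locally (f x))) ->
  filterlim (dualsum c (p, z)) eventually (locally (latticeRule f p z)).
Proof.
move=> p0 fx.
pose x (k : 'I_p) j := frac_part (INR k * INR (z j) / INR p).
have xI k j : 0 <= x k j <= 1 by rewrite /x; case: (base_fp (INR k * INR (z j) / INR p)); lra.
have L := @filterlim_sumC _ (index_enum 'I_p) _ _ (fun k => fx _ (xI k)).
have := filterlim_comp _ _ _ _ _ _ _ _ L
  (@filterlim_scal_r C_AbsRing C_NormedModule (RtoC (/ INR p)) _).
apply: filterlim_ext => N; rewrite /dualsum /boxsumC.
change (Cmult (RtoC (/ INR p)) (\big[Cplus/RtoC 0]_(k < p)
   \big[Cplus/RtoC 0]_(g : {ffun 'I_d -> 'I_(2 * N + 1)})
      Cmult (c (boxpt g)) (e2pi (dotZR (boxpt g) (x k)))) =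
  \big[Cplus/RtoC 0]_(g : {ffun 'I_d -> 'I_(2 * N + 1)})
      (if dual (p, z) (boxpt g) then c (boxpt g) else RtoC 0)).
have mulC (a : C) (J : Type) (r : seq J) (F : J -> C) :
    Cmult a (\big[Cplus/RtoC 0]_(i <- r) F i) = \big[Cplus/RtoC 0]_(i <- r) Cmult a (F i).
  by apply: (big_morph (Cmult a)) => [u v|]; ring.
rewrite exchange_big mulC; apply: eq_bigr => g _.
rewrite -(mulC (c (boxpt g))) Cmult_assoc (Cmult_comm (RtoC _)) -Cmult_assoc.
rewrite (lattice_e2pi (boxpt g) z p0).
by case: ifP; rewrite ?Cmult_1_r ?Cmult_0_r.
Qed.

(** The zero frequency is dual for every draw and lies in every box, so its coefficient cancels. *)
Lemma dualsum_le d (c : ('I_d -> Z) -> C) x N :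
  Cmod (Cminus (c (fun=> 0%Z)) (dualsum c x N)) <=
  boxsumR N (fun h => if dual x h && nontrivial h then Cmod (c h) else 0).
Proof.
have [g0 e0] := @boxpt_surj d N (fun=> 0%Z) ltac:(lia).
have nz0 : nontrivial (boxpt g0) = false.
  by rewrite e0; apply/existsP => -[j]; rewrite Z.eqb_refl.
have d0 : dual x (boxpt g0).
  by rewrite e0 /dual /dotZ big1.
rewrite /dualsum /boxsumC (bigD1 g0) //= d0 e0.
set S := \big[_/_]_(_ | _) _.
rewrite (_ : Cminus _ _ = Copp S); last by rewrite /Cminus; ring.
rewrite Cmod_opp; apply: Rle_trans (Cmod_sum _ _ _) _.
rewrite /boxsumR [X in _ <= X](bigD1 g0) //= nz0 andbF Rplus_0_l; apply: sumR_le => g gg0.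
suff -> : nontrivial (boxpt g) by rewrite andbT; case: ifP => _; rewrite ?Cmod_0; lra.
apply: contraT => /existsPn nz; case/negP: gg0; apply/eqP; apply: (@boxpt_inj d N); rewrite e0.
by apply: functional_extensionality => j; have := nz j; rewrite negbK => /Z.eqb_spec.
Qed.

Lemma fhat0 d (f : ('I_d -> R) -> C) : fhat f (fun=> 0%Z) = Iint f.
Proof.
rewrite /fhat; congr Iint; apply: functional_extensionality => x.
rewrite (_ : dotZR _ x = 0) ?Ropp_0 ?e2pi0 ?Cmult_1_r //.
by rewrite /dotZR big1 // => j _; rewrite Rmult_0_l.
Qed.

Lemma latticeRule_error_lim d (f : ('I_d -> R) -> C) p z : (0 < p)%N ->
  (forall x : 'I_d -> R, (forall j, 0 <= x j <= 1) ->
     filterlim (fun N => boxsumC N (fun h => Cmult (fhat f h) (e2pi (dotZR h x))))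
       eventually (locally (f x))) ->
  is_lim_seq (fun N => Cmod (Cminus (Iint f) (dualsum (fhat f) (p, z) N)))
    (Cmod (Cminus (Iint f) (latticeRule f p z))).
Proof.
move=> p0 fx; have L := latticeRule_lim (z := z) p0 fx.
have L1 := filterlim_comp _ _ _ _ _ _ _ _ L (@filterlim_opp C_AbsRing C_NormedModule _).
have L2 := filterlim_comp_2 _ _ _ (@filterlim_const _ C_UniformSpace eventually _ (Iint f)) L1
  (@filterlim_plus C_AbsRing C_NormedModule _ _).
have L3 := filterlim_comp _ _ _ _ _ _ _ _ (L2 _ _) (@filterlim_norm C_AbsRing C_NormedModule _).
exact: L3.
Qed.

(** * Error bounds for a single draw *)

Lemma is_lim_seq_sumR (I : eqType) (r : seq I) (u : I -> nat -> R) (l : I -> R) :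
  (forall i, i \in r -> is_lim_seq (u i) (l i)) ->
  is_lim_seq (fun N => \big[Rplus/0]_(i <- r) u i N) (\big[Rplus/0]_(i <- r) l i).
Proof.
elim: r => [|i r IH] h.
  rewrite big_nil; apply: (is_lim_seq_ext (fun=> 0)); last exact: is_lim_seq_const.
  by move=> N; rewrite big_nil.
rewrite big_cons; apply: (is_lim_seq_ext (fun N => u i N + \big[Rplus/0]_(i <- r) u i N)).
  by move=> N; rewrite big_cons.
apply: is_lim_seq_plus'; first by apply: h; rewrite mem_head.
by apply: IH => j jr; apply: h; rewrite inE jr orbT.
Qed.

Lemma is_lim_seq_scal_fin (u : nat -> R) a (l : R) :
  is_lim_seq u l -> is_lim_seq (fun N => a * u N) (a * l).
Proof. exact: (is_lim_seq_scal_l u a l). Qed.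

Lemma is_lim_seq_Edraw d n (u : nat -> nat * ('I_d -> nat) -> R) (l : nat * ('I_d -> nat) -> R) :
  (forall x, x.1 \in primesP n -> is_lim_seq (fun N => u N x) (l x)) ->
  is_lim_seq (fun N => Edraw n (u N)) (Edraw n l).
Proof.
move=> h; apply: is_lim_seq_scal_fin.
apply: (@is_lim_seq_sumR _ _ (fun p N => / INR (p.-1 ^ d) *
  \big[Rplus/0]_(w : {ffun 'I_d -> 'I_(p.-1)}) u N (p, shift_ord w))) => p pP.
apply: is_lim_seq_scal_fin.
apply: (@is_lim_seq_sumR _ _ (fun w N => u N (p, shift_ord w))) => w _.
exact: (h (p, shift_ord w)).
Qed.

(** The partial sums are nondecreasing and bounded, so [Lim_seq] is a finite limit that dominates
    each of them. *)
Lemma korobovNorm_partial d alpha gamma (f : ('I_d -> R) -> C) N :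
  inKorobov alpha gamma f ->
  sqrt (boxsumR N (fun h => (rw alpha gamma h) ^ 2 * (Cmod (fhat f h)) ^ 2)) <=
  korobovNorm alpha gamma f.
Proof.
move=> [_ [_ [M hM]]]; set F := fun h => _; apply: sqrt_le_1_alt.
have F0 h : 0 <= F h by apply: Rmult_le_pos; exact: pow2_ge_0.
have inc k : boxsumR k F <= boxsumR k.+1 F by apply: boxsumR_mono.
have [l hl] := ex_finite_lim_seq_incr _ M inc hM.
by rewrite (is_lim_seq_unique _ _ hl); exact: (is_lim_seq_incr_compare _ _ hl inc).
Qed.

Lemma boxsumR_le d N (F G : ('I_d -> Z) -> R) : (forall h, F h <= G h) ->
  boxsumR N F <= boxsumR N G.
Proof. by move=> FG; apply: sumR_le. Qed.

Lemma boxsumR_mull d N c (F : ('I_d -> Z) -> R) :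
  boxsumR N (fun h => c * F h) = c * boxsumR N F.
Proof. by rewrite /boxsumR sumR_mull. Qed.

Lemma Rpower_le_neg x y a : 0 < x <= y -> a <= 0 -> Rpower y a <= Rpower x a.
Proof.
move=> xy a0; rewrite -(Ropp_involutive a) !(Rpower_Ropp _ (- a)).
apply: Rinv_le_contravar; first exact: Rpower_gt0.
by apply: Rle_Rpower_l; lra.
Qed.

Lemma sqrt_Rpower x a : sqrt (Rpower x a) = Rpower x (a / 2).
Proof.
by rewrite -Rpower_sqrt ?Rpower_mult; [|exact: Rpower_gt0]; congr Rpower; lra.
Qed.

(** Size of one chosen nonzero coordinate, fixed as a function of [h] so that it can weight a sum;
    the value 1 is a default for [h = 0]. *)
Definition coord d (h : 'I_d -> Z) : R :=
  if [pick j | ~~ Z.eqb (h j) 0] is Some j then IZR (Z.abs (h j)) else 1.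

Lemma coordP d (h : 'I_d -> Z) : nontrivial h ->
  exists2 j, ~~ Z.eqb (h j) 0 & coord h = IZR (Z.abs (h j)).
Proof.
rewrite /coord; case: pickP => [j hj _|e]; first by exists j.
by move=> /existsP[j]; rewrite e.
Qed.

(** From [2^w <= |z|] follows [2^(w del) <= |z|^del], and the left side is at least [w del ln 2]. *)
Lemma count_prime_divisors_le del n z : 0 < del -> ~~ Z.eqb z 0 ->
  INR (count (fun p => p %| Z.abs_nat z)%N (primesP n)) <=
  / (del * ln 2) * Rpower (IZR (Z.abs z)) del.
Proof.
move=> d0 z0; set w := count _ _.
have ln2 : 0 < ln 2 by rewrite -ln_1; apply: ln_increasing; lra.
have : (2 ^ w <= Z.abs_nat z)%N.
  apply: expn2_count_dvdn; [exact/filter_uniq/iota_uniq | exact: filter_all |].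
  by move/Z.eqb_spec: z0; lia.
move=> /INR_leq; rewrite INR_expn (INR_IZR_INZ (Z.abs_nat z)) Zabs2Nat.id_abs => h.
apply: (Rmult_le_reg_l (del * ln 2)); first exact: Rmult_lt_0_compat.
rewrite -Rmult_assoc Rinv_r ?Rmult_1_l; last by have := Rmult_lt_0_compat _ _ d0 ln2; lra.
have h2 : Rpower (INR 2 ^ w) del <= Rpower (IZR (Z.abs z)) del.
  by apply: Rle_Rpower_l; [lra | split => //; apply: pow_lt; rewrite /=; lra].
apply: Rle_trans h2; rewrite -Rpower_pow; last by rewrite /=; lra.
rewrite Rpower_mult /Rpower (_ : INR 2 = 2) //.
by have := exp_ineq1_le (INR w * del * ln 2); lra.
Qed.

Section Bounds.
Variables (d n : nat) (lam del alpha cP : R) (gamma : {fset nat} -> R).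
Variable c : ('I_d -> Z) -> C.
Implicit Type h : 'I_d -> Z.
Variable A : R.
Hypotheses (lam_gt : 1 / 2 < lam) (lam_lt : lam < alpha).
Hypotheses (del_gt0 : 0 < del) (del_lt : del < lam - 1 / 2).
Hypothesis gammaP : forall u, 0 < gamma u <= 1.
Hypothesis d_gt0 : (0 < d)%N.
Hypothesis n_ge2 : (2 <= n)%N.
Hypothesis P_neq0 : primesP n <> [::].
Hypothesis cP_gt0 : 0 < cP.
Hypothesis P_lower : cP * Rpower (INR n) (1 - del / 2) <= INR (size (primesP n)).
Hypothesis normA : forall N,
  sqrt (boxsumR N (fun h => (rw alpha gamma h) ^ 2 * (Cmod (c h)) ^ 2)) <= A.

Let V := Vd d alpha lam gamma.
Let r h := @rw d alpha gamma h.
(** The threshold solves [(2/n) R0^(1/lam) V = 1/64], the target for the probability of a bad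
    draw. *)
Let R0 := Rpower (INR n / (128 * V)) lam.

Let V_gt0 : 0 < V. Proof. exact: Vd_gt0. Qed.
Let n_ge2R : 2 <= INR n. Proof. by have := INR_leq n_ge2; rewrite /=; lra. Qed.
Let r_gt0 h : 0 < r h. Proof. exact: rw_gt0. Qed.
Let A_ge0 : 0 <= A. Proof. exact: Rle_trans (sqrt_pos _) (normA 0). Qed.

(** Cauchy-Schwarz between [r |c|], whose square sum is bounded by [A^2], and [w / r], whose square
    sum is at most [B V]. It is used with [w = 1] on all nonzero frequencies and with
    [w = coord^(del/2)] on the tail. *)
Lemma boxsumR_weight_le N (S : pred ('I_d -> Z)) (w : ('I_d -> Z) -> R) B : 0 <= B ->
  (forall h, S h -> nontrivial h) ->
  (forall h, S h -> w h ^ 2 * Rpower (r h) (- 2) <= B * Rpower (r h) (- (1 / lam))) ->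
  boxsumR N (fun h => if S h then Cmod (c h) * w h else 0) <= A * sqrt (B * V).
Proof.
move=> B0 Snt wB.
have r2 h : Rpower (r h) (- 2) = (/ r h) ^ 2.
  by rewrite (_ : - 2 = - INR 2) ?Rpower_Ropp ?Rpower_pow ?pow_inv //; rewrite /=; lra.
pose F h := r h * Cmod (c h); pose G h := if S h then w h / r h else 0.
have -> : boxsumR N (fun h => if S h then Cmod (c h) * w h else 0) = boxsumR N (fun h => F h * G h).
  apply: eq_bigr => g _; rewrite /F /G; case: ifP => _; last by rewrite Rmult_0_r.
  by field; have := r_gt0 (boxpt g); lra.
apply: Rle_trans (cauchy_schwarz _ _ _ _) _.
apply: Rmult_le_compat; try exact: sqrt_pos.
  apply: Rle_trans (normA N); apply: sqrt_le_1_alt; apply: Req_le.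
  by apply: eq_bigr => g _; rewrite /F Rpow_mult_distr.
apply: sqrt_le_1_alt.
apply: (Rle_trans _ (B * boxsumR N (fun h => if nontrivial h then Rpower (r h) (- (1 / lam)) else 0))).
  rewrite -boxsumR_mull; apply: sumR_le => g _; rewrite /G.
  case: ifP => [Sg|_].
    rewrite (Snt _ Sg); apply: Rle_trans (wB _ Sg); rewrite r2 /Rdiv Rpow_mult_distr; lra.
  rewrite pow_ne_zero //; apply: Rmult_le_pos => //.
  by case: ifP => _; [exact/Rlt_le/Rpower_gt0 | lra].
apply: Rmult_le_compat_l => //; exact: boxsumR_rw_le.
Qed.

Lemma rw_ge_Vd h : nontrivial h -> Rpower V (- lam) <= r h.
Proof.
move=> /existsP[j hj].
have := coord_le_Vd_rw lam_gt lam_lt gammaP hj; rewrite -/V -/(r h) => h1.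
have h2 : 1 <= Rpower (IZR (Z.abs (h j))) alpha.
  rewrite -(Rpower_O (IZR (Z.abs (h j)))); last by have := abs_IZR_ge1 hj; lra.
  by apply: Rle_Rpower; [exact: abs_IZR_ge1 | lra].
apply: (Rmult_le_reg_l (Rpower V lam)); first exact: Rpower_gt0.
by rewrite -Rpower_plus Rplus_opp_r Rpower_O //; lra.
Qed.

Lemma boxsumR_abs_le N :
  boxsumR N (fun h => if nontrivial h then Cmod (c h) else 0) <= A * Rpower V lam.
Proof.
have e1 : 1 / lam < 2.
  by apply: (Rmult_lt_reg_r lam); [lra | rewrite /Rdiv Rmult_assoc Rinv_l; lra].
have -> : Rpower V lam = sqrt (Rpower V (2 * lam - 1) * V).
  rewrite -{3}(Rpower_1 V) // -Rpower_plus sqrt_Rpower; congr Rpower; lra.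
have <- : boxsumR N (fun h => if nontrivial h then Cmod (c h) * 1 else 0) =
    boxsumR N (fun h => if nontrivial h then Cmod (c h) else 0).
  by apply: eq_bigr => g _; rewrite Rmult_1_r.
(* Here [B = V^(2 lam - 1)], which comes from [r >= V^(-lam)] raised to the power [-(2 - 1/lam)]. *)
apply: (@boxsumR_weight_le N (@nontrivial d) (fun=> 1)) => // [|h hn].
  exact/Rlt_le/Rpower_gt0.
rewrite pow1 Rmult_1_l (_ : - 2 = - (2 - 1 / lam) + - (1 / lam)); last by lra.
rewrite Rpower_plus; apply: Rmult_le_compat_r; first exact/Rlt_le/Rpower_gt0.
apply: (Rle_trans _ (Rpower (Rpower V (- lam)) (- (2 - 1 / lam)))).
  by apply: Rpower_le_neg; [split; [exact: Rpower_gt0 | exact: rw_ge_Vd] | lra].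
by rewrite Rpower_mult; apply: Req_le; congr Rpower; field; lra.
Qed.

Lemma boxsumR_tail_le N :
  boxsumR N (fun h => if nontrivial h && Rleb R0 (r h)
    then Cmod (c h) * Rpower (coord h) (del / 2) else 0) <=
  A * (Rpower V lam * Rpower (INR n / 128) (- (lam - 1 / 2 - del / 2))).
Proof.
(* The exponent of decay that remains after [coord^del <= V^del r^(del/lam)] and after setting aside
   [r^(-1/lam)] for the sum. On the tail [r^(-s) <= R0^(-s)], so [B = V^del R0^(-s)]. *)
pose s := 2 - 1 / lam - del / lam.
have s0 : 0 <= s.
  apply: (Rmult_le_reg_r lam); first lra.
  by rewrite /s (_ : (2 - 1 / lam - del / lam) * lam = 2 * lam - 1 - del); [lra | field; lra].
have R0_gt0 : 0 < R0 by apply: Rpower_gt0.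
have n128 : 0 < INR n / 128 by lra.
have -> : Rpower V lam * Rpower (INR n / 128) (- (lam - 1 / 2 - del / 2)) =
    sqrt (Rpower V del * Rpower R0 (- s) * V).
  have -> : Rpower R0 (- s) = Rpower V (2 * lam - 1 - del) * Rpower (INR n / 128) (- (2 * lam - 1 - del)).
    rewrite /R0 Rpower_mult (_ : lam * - s = - (2 * lam - 1 - del)); last by rewrite /s; field; lra.
    have -> : INR n / (128 * V) = INR n / 128 * / V by field; lra.
    rewrite -Rpower_mult_distr //; last exact: Rinv_0_lt_compat.
    rewrite Rmult_comm; congr (_ * _).
    by rewrite /Rpower ln_Rinv //; congr exp; ring.
  have -> : Rpower V del * (Rpower V (2 * lam - 1 - del) * Rpower (INR n / 128) (- (2 * lam - 1 - del))) * V
     = Rpower V (2 * lam) * Rpower (INR n / 128) (- (2 * lam - 1 - del)).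
    have -> : Rpower V (2 * lam) = Rpower V del * Rpower V (2 * lam - 1 - del) * V.
      by rewrite -{4}(Rpower_1 V) // -!Rpower_plus; congr Rpower; ring.
    by ring.
  rewrite sqrt_mult; try exact/Rlt_le/Rpower_gt0.
  by rewrite !sqrt_Rpower; congr (Rpower _ _ * Rpower _ _); lra.
apply: (@boxsumR_weight_le N (fun h => nontrivial h && Rleb R0 (r h))) => [|h /andP[] //|h /andP[hn /RlebP hR]].
  by apply: Rmult_le_pos; exact/Rlt_le/Rpower_gt0.
have [j hj ->] := coordP hn; have z1 := abs_IZR_ge1 hj; set z := IZR (Z.abs _) in z1 *.
have -> : Rpower z (del / 2) ^ 2 = Rpower z del.
  by rewrite /= Rmult_1_r -Rpower_plus; congr Rpower; lra.
have h1 : Rpower z del <= Rpower V del * Rpower (r h) (del / lam).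
  apply: (Rle_trans _ (Rpower (Rpower z alpha) (del / lam))).
    rewrite Rpower_mult; apply: Rle_Rpower => //.
    rewrite (_ : alpha * (del / lam) = del * (alpha / lam)); last by field; lra.
    by have := exponent_gt1 lam_gt lam_lt; nra.
  apply: (Rle_trans _ (Rpower (Rpower V lam * r h) (del / lam))).
    apply: Rle_Rpower_l; first by apply: Rlt_le; apply: Rdiv_lt_0_compat; lra.
    by split; [exact: Rpower_gt0 | exact: coord_le_Vd_rw].
  rewrite -Rpower_mult_distr //; last exact: Rpower_gt0.
  by rewrite Rpower_mult; apply: Req_le; congr (Rpower _ _ * _); field; lra.
apply: (Rle_trans _ (Rpower V del * Rpower (r h) (del / lam) * Rpower (r h) (- 2))).
  by apply: Rmult_le_compat_r => //; exact/Rlt_le/Rpower_gt0.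
rewrite !Rmult_assoc; apply: Rmult_le_compat_l; first exact/Rlt_le/Rpower_gt0.
rewrite -Rpower_plus (_ : del / lam + - 2 = - s + - (1 / lam)); last by rewrite /s; lra.
rewrite Rpower_plus; apply: Rmult_le_compat_r; first exact/Rlt_le/Rpower_gt0.
by apply: Rpower_le_neg; lra.
Qed.

(** The first summand comes from the collision probability [2/n], the second from the prime-divisor
    count with exponent [del/2] divided by [|P_n| >= cP n^(1 - del/2)]. *)
Definition dualC := 2 + 2 / (del * ln 2 * cP).

Lemma dualC_gt0 : 0 < dualC.
Proof.
have ln2 : 0 < ln 2 by rewrite -ln_1; apply: ln_increasing; lra.
have : 0 < 2 / (del * ln 2 * cP).
  by apply: Rdiv_lt_0_compat; [lra | do 2?apply: Rmult_lt_0_compat].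
by rewrite /dualC; lra.
Qed.

Lemma Edraw_dual_coord_le (h : 'I_d -> Z) : nontrivial h ->
  Edraw n (fun x => if dual x h then 1 else 0) <=
  dualC * Rpower (INR n) (- 1 + del / 2) * Rpower (coord h) (del / 2).
Proof.
move=> hn; have [j hj ->] := coordP hn.
apply: Rle_trans (Edraw_dual_le P_neq0 h j ltac:(lia)) _.
have ln2 : 0 < ln 2 by rewrite -ln_1; apply: ln_increasing; lra.
have z1 := abs_IZR_ge1 hj; set z := IZR (Z.abs _) in z1 *.
have E1 : 1 <= Rpower z (del / 2) by rewrite -[X in X <= _](Rpower_O z); [apply: Rle_Rpower; lra | lra].
set E := Rpower z _ in E1 *; set Y := Rpower (INR n) (- 1 + del / 2).
have Y0 : 0 < Y by apply: Rpower_gt0.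
have h1 : 2 / INR n <= 2 * Y * E.
  have : / INR n <= Y.
    rewrite -{1}(Rpower_1 (INR n)) -?Rpower_Ropp; last lra.
    by apply: Rle_Rpower; lra.
  by rewrite /Rdiv; nra.
have h2 := count_prime_divisors_le n (Rdiv_lt_0_compat _ _ del_gt0 Rlt_0_2) hj.
rewrite -/z -/E in h2.
set w := INR (count _ _) in h2 *; set S := INR (size _).
have S0 : 0 < S by apply: size_primesP_gt0.
have SY : / S <= / cP * Y.
  rewrite (_ : / cP * Y = / (cP * Rpower (INR n) (1 - del / 2))); last first.
    by rewrite Rinv_mult -Rpower_Ropp; congr (_ * Rpower _ _); lra.
  apply: Rinv_le_contravar P_lower.
  by apply: Rmult_lt_0_compat => //; exact: Rpower_gt0.
have : w / S <= / (del / 2 * ln 2) * E * (/ cP * Y).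
  apply: Rmult_le_compat => //; first exact: pos_INR.
  exact/Rlt_le/Rinv_0_lt_compat.
rewrite (_ : / (del / 2 * ln 2) * E * (/ cP * Y) = 2 / (del * ln 2 * cP) * Y * E); last by field; lra.
by rewrite /dualC; lra.
Qed.

(** The condition ranges over infinitely many frequencies, so it is made Boolean by excluded
    middle. *)
Definition good (x : nat * ('I_d -> nat)) : bool :=
  if excluded_middle_informative (forall h : 'I_d -> Z, nontrivial h -> dual x h -> R0 <= r h)
  then true else false.

Lemma goodP x : reflect (forall h, nontrivial h -> dual x h -> R0 <= r h) (good x).
Proof. by rewrite /good; case: excluded_middle_informative => h; constructor. Qed.

(** For a good draw only frequencies with [r h >= R0] can be dual. Exchanging expectation and sum
    brings in the duality probability of each [h], and the tail bound finishes. *)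
Lemma Edraw_good_dualsum_le N :
  Edraw n (fun x => if good x then Cmod (Cminus (c (fun=> 0%Z)) (dualsum c x N)) else 0) <=
  dualC * Rpower (INR n) (- 1 + del / 2) *
    (A * (Rpower V lam * Rpower (INR n / 128) (- (lam - 1 / 2 - del / 2)))).
Proof.
pose S h := nontrivial h && Rleb R0 (r h).
have D0 := dualC_gt0; have Y0 := Rpower_gt0 (INR n) (- 1 + del / 2).
apply: (Rle_trans _ (Edraw n (fun x =>
    boxsumR N (fun h => if S h then Cmod (c h) * (if dual x h then 1 else 0) else 0)))).
  apply: Edraw_le => // x _; case: (goodP x) => [gx|_]; last first.
    apply: sumR_ge0 => g _; case: ifP => _; last lra.
    by apply: Rmult_le_pos; [exact: Cmod_ge_0 | case: ifP => _; lra].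
  apply: Rle_trans (dualsum_le c x N) _; apply: boxsumR_le => h; rewrite /S.
  case: (boolP (dual x h)) => hd; case: (boolP (nontrivial h)) => hn /=; try lra.
    by have /RlebP -> := gx h hn hd; lra.
  by case: ifP => _; have := Cmod_ge_0 (c h); lra.
rewrite /boxsumR Edraw_sum //.
apply: Rle_trans (Rmult_le_compat_l _ _ _ _ (boxsumR_tail_le N)); last first.
  exact/Rlt_le/Rmult_lt_0_compat.
rewrite -boxsumR_mull; apply: sumR_le => g _; cbv beta; rewrite -/(S (boxpt g)).
case: (boolP (S (boxpt g))) => [/andP[hn _]|_]; last by rewrite Edraw_const // Rmult_0_r; lra.
rewrite EdrawZ (Rmult_comm (Cmod _) (Rpower _ _)) -Rmult_assoc Rmult_comm.
apply: Rmult_le_compat_r; [exact: Cmod_ge_0 | exact: Edraw_dual_coord_le].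
Qed.

(** The expectation is at most 1 plus 63 times the expected number of dual frequencies with
    [r h < R0], and a union bound makes that number at most 1/64. *)
Lemma Edraw_bad_le : Edraw n (fun x => if good x then 1 else 64) <= 2.
Proof.
(* Every [h] with [r h < R0] has coordinates of size at most [R0^(1/alpha)], so the union bound runs
   over a finite box. *)
pose K := Z.to_nat (up (Rpower R0 (/ alpha))).
have R0_gt0 : 0 < R0 by apply: Rpower_gt0.
have KR : Rpower R0 (/ alpha) <= INR K.
  have [u1 _] := archimed (Rpower R0 (/ alpha)).
  rewrite /K INR_IZR_INZ Z2Nat.id; first lra.
  by apply: le_IZR; have := Rpower_gt0 R0 (/ alpha); lra.
have inK h j : r h < R0 -> (Z.abs (h j) <= Z.of_nat K)%Z.
  move=> hR; case: (Z.eqb_spec (h j) 0) => [->|hj]; first by lia.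
  have hj' : ~~ Z.eqb (h j) 0 by apply/Z.eqb_spec.
  apply: le_IZR; rewrite -INR_IZR_INZ; apply: Rle_trans KR.
  have z1 := abs_IZR_ge1 hj'.
  have -> : IZR (Z.abs (h j)) = Rpower (Rpower (IZR (Z.abs (h j))) alpha) (/ alpha).
    by rewrite Rpower_mult Rinv_r ?Rpower_1; lra.
  apply: Rle_Rpower_l; first by apply: Rlt_le; apply: Rinv_0_lt_compat; lra.
  split; first exact: Rpower_gt0.
  by have := coord_le_rw1 lam_gt lam_lt gammaP hj'; rewrite -/(r h); lra.
pose S h := nontrivial h && ~~ Rleb R0 (r h).
apply: (Rle_trans _ (Edraw n (fun x =>
    1 + 63 * boxsumR K (fun h => if S h then (if dual x h then 1 else 0) else 0)))).
  apply: Edraw_le => // x _.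
  have nn h : 0 <= (if S h then (if dual x h then 1 else 0) else 0).
    by case: ifP => _; [case: ifP => _|]; lra.
  have sum0 : 0 <= boxsumR K (fun h => if S h then (if dual x h then 1 else 0) else 0).
    by apply: sumR_ge0.
  case: (goodP x) => [_|bx]; first lra.
  have [h [hn [hd hR]]] : exists h, nontrivial h /\ dual x h /\ r h < R0.
    apply: NNPP => nex; apply: bx => h hn hd; apply: Rnot_lt_le => hR.
    by apply: nex; exists h.
  have [g eg] := boxpt_surj (fun j => inK h j hR).
  have Sh : S h by rewrite /S hn; apply/RlebP; lra.
  have : 1 <= boxsumR K (fun h => if S h then (if dual x h then 1 else 0) else 0).
    rewrite /boxsumR (bigD1 g) //= eg Sh hd -[X in X <= _]Rplus_0_r.
    by apply: Rplus_le_compat_l; apply: sumR_ge0.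
  by lra.
rewrite EdrawD // Edraw_const // EdrawZ /boxsumR Edraw_sum //.
set B := \big[_/_]_(_ | _) _.
suff : B <= 1 / 64 by lra.
apply: (Rle_trans _ (2 / INR n * Rpower R0 (1 / lam) *
   boxsumR K (fun h => if nontrivial h then Rpower (r h) (- (1 / lam)) else 0))).
  rewrite -boxsumR_mull; apply: sumR_le => g _; set h := boxpt g.
  have p0 : 0 < 2 / INR n * Rpower R0 (1 / lam).
    by apply: Rmult_lt_0_compat; [apply: Rdiv_lt_0_compat; lra | exact: Rpower_gt0].
  rewrite -/(S h); case: (boolP (S h)) => [/andP[hn /RlebP hR]|_]; last first.
    rewrite Edraw_const //; apply: Rmult_le_pos; first lra.
    by case: ifP => _; [exact/Rlt_le/Rpower_gt0 | lra].
  rewrite hn; have [j hj] := existsP hn.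
  apply: Rle_trans (Edraw_dual_le P_neq0 h j ltac:(lia)) _.
  (* A prime of [P_n] dividing [h_j] would force [|h_j| >= n/2], hence [V^lam r >= (n/2)^alpha >=
     (n/128)^lam = V^lam R0], against [r h < R0]. Raising the exponent from [lam] to [alpha] uses
     [n/2 >= 1]. *)
  have -> : count (fun p => p %| Z.abs_nat (h j))%N (primesP n) = 0%N.
    apply/eqP; rewrite eqn0Ngt -has_count; apply/hasPn => p pP.
    apply/negP => /dvdn_leq pz; have [pp pn] := mem_primesP pP.
    have hz : INR n / 2 <= IZR (Z.abs (h j)).
      apply: Rle_trans pn _; rewrite -Zabs2Nat.id_abs -INR_IZR_INZ; apply: INR_leq.
      have := pz ltac:(move/Z.eqb_spec: hj; lia); lia.
    apply: hR; apply: (Rmult_le_reg_l (Rpower V lam)); first exact: Rpower_gt0.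
    apply: Rle_trans (coord_le_Vd_rw lam_gt lam_lt gammaP hj).
    apply: (Rle_trans _ (Rpower (INR n / 2) lam)).
      rewrite /R0 Rpower_mult_distr //; last by apply: Rdiv_lt_0_compat; lra.
      apply: Rle_Rpower_l; first lra.
      by rewrite (_ : V * (INR n / (128 * V)) = INR n / 128); [lra | field; lra].
    apply: (Rle_trans _ (Rpower (INR n / 2) alpha)); first by apply: Rle_Rpower; lra.
    by apply: Rle_Rpower_l; lra.
  rewrite /Rdiv Rmult_0_l Rplus_0_r -[X in X <= _]Rmult_1_r -/(Rdiv 2 _) Rmult_assoc.
  apply: Rmult_le_compat_l; first by apply: Rlt_le; apply: Rdiv_lt_0_compat; lra.
  apply: (Rle_trans _ (Rpower (r h) (1 / lam) * Rpower (r h) (- (1 / lam)))).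
    by rewrite -Rpower_plus Rplus_opp_r Rpower_O //; lra.
  apply: Rmult_le_compat_r; first exact/Rlt_le/Rpower_gt0.
  apply: Rle_Rpower_l; last by split => //; apply: Rlt_le; apply: Rnot_le_lt.
  by apply: Rlt_le; apply: Rdiv_lt_0_compat; lra.
have -> : Rpower R0 (1 / lam) = INR n / (128 * V).
  rewrite /R0 Rpower_mult (_ : lam * (1 / lam) = 1) ?Rpower_1 //; last by field; lra.
  by apply: Rdiv_lt_0_compat; lra.
apply: (Rle_trans _ (2 / INR n * (INR n / (128 * V)) * V)).
  apply: Rmult_le_compat_l; last exact: boxsumR_rw_le.
  by apply: Rmult_le_pos; apply: Rlt_le; apply: Rdiv_lt_0_compat; lra.
by apply: Req_le; field; lra.
Qed.

End Bounds.

(** * Expected error of the median and the final bound *)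

Lemma lim_le_const (u : nat -> R) (l b : R) :
  (forall N, u N <= b) -> is_lim_seq u l -> l <= b.
Proof. by move=> ub ul; exact: (is_lim_seq_le _ _ _ _ ub ul (is_lim_seq_const b)). Qed.

Lemma ceilR_ge x : x <= IZR (ceilR x).
Proof. by rewrite /ceilR opp_IZR; have [h _] := base_Int_part (- x); lra. Qed.

(** The number of samples is odd, so there is at least one draw, and its sum over the primes is
    empty. *)
Lemma expectedError_nil d (h : nat -> R) n (f : ('I_d -> R) -> C) :
  primesP n = [::] -> expectedError h n f = 0.
Proof. by rewrite /expectedError /Nsamp addn1 /= => ->; rewrite big_nil Rmult_0_r. Qed.

Section Draws.
Variables (d n T : nat) (f : ('I_d -> R) -> C) (W K : R).
Variable good : nat * ('I_d -> nat) -> bool.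
Hypothesis P_neq0 : primesP n <> [::].
Hypothesis W_ge0 : 0 <= W.
Hypothesis errW : forall x, x.1 \in primesP n -> Cmod (Cminus (Iint f) (latticeRule f x.1 x.2)) <= W.
Hypothesis errK : Edraw n (fun x =>
  if good x then Cmod (Cminus (Iint f) (latticeRule f x.1 x.2)) else 0) <= K.
Hypothesis bad_le : Edraw n (fun x => if good x then 1 else 64) <= 2.

(** The good part costs [4 (2T+1) K / (T+1) <= 8 K]. The moment of the bad draws is at most
    [2^(2T+1) = 2 * 4^T], and against [8^(T+1)] it leaves [W / 2^(T+1)]. *)
Lemma Edraws_median_le :
  Edraws n (2 * T + 1) (fun ds => Cmod (Cminus (Iint f) (Mn f ds))) <= 8 * K + W / 2 ^ T.
Proof.
have T0 : 0 < INR T.+1 by apply: lt_0_INR; lia.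
have p8 : 0 < 8 ^ T.+1 by apply: pow_lt; lra.
apply: (Rle_trans _ (Edraws n (2 * T + 1) (fun l =>
    4 / INR T.+1 * \big[Rplus/0]_(x <- l)
      (if good x then Cmod (Cminus (Iint f) (latticeRule f x.1 x.2)) else 0) +
    2 * W / 8 ^ T.+1 * \big[Rmult/1]_(x <- l) (if good x then 1 else 64)))).
  apply: Edraws_le => // l sl lP.
  apply: (@medianC_error _ (0%N, fun=> 0%N) _ T (fun x => latticeRule f x.1 x.2)) => // i il.
  by apply: errW; apply: lP; rewrite -sl.
rewrite EdrawsD // !EdrawsZ // Edraws_sum // Edraws_prod //.
have eK := errK; have b2 := bad_le.
set E1 := Edraw n _ in eK *; set E2 := Edraw n _ in b2 *.
have E1_0 : 0 <= E1.
  rewrite -(Edraw_const d P_neq0 0); apply: Edraw_le => // x _.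
  by case: ifP => _; [exact: Cmod_ge_0 | lra].
have E2_0 : 0 <= E2.
  rewrite -(Edraw_const d P_neq0 0); apply: Edraw_le => // x _.
  by case: ifP => _; lra.
apply: Rplus_le_compat.
  have TN : INR (2 * T + 1) <= 2 * INR T.+1.
    by rewrite -[2]/(INR 2) -mult_INR; apply: INR_leq; lia.
  rewrite (_ : 8 * K = 4 / INR T.+1 * (2 * INR T.+1 * K)); last by field; lra.
  apply: Rmult_le_compat_l; first by apply: Rlt_le; apply: Rdiv_lt_0_compat; lra.
  by apply: Rmult_le_compat => //; exact: pos_INR.
have p2 : E2 ^ (2 * T + 1) <= 2 ^ (2 * T + 1) by apply: pow_incr.
have e2 : 2 ^ (2 * T + 1) = 2 * 4 ^ T.
  by rewrite pow_add pow_mult (_ : 2 ^ 2 = 4); lra.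
have e8 : 8 ^ T = 4 ^ T * 2 ^ T by rewrite -Rpow_mult_distr; congr pow; lra.
have p4 : 0 < 4 ^ T by apply: pow_lt; lra.
have p2' : 0 < 2 ^ T by apply: pow_lt; lra.
apply: (Rle_trans _ (2 * W / 8 ^ T.+1 * (2 * 4 ^ T))).
  apply: Rmult_le_compat_l; last by rewrite -e2.
  by apply: Rmult_le_pos; [lra | exact/Rlt_le/Rinv_0_lt_compat].
have -> : 2 * W / 8 ^ T.+1 * (2 * 4 ^ T) = W / 2 ^ T * (/ 2).
  by rewrite /= e8; field; lra.
have : 0 <= W / 2 ^ T by apply: Rmult_le_pos => //; exact/Rlt_le/Rinv_0_lt_compat.
by lra.
Qed.
End Draws.

Lemma pow2_samples_ge n x : (2 <= n)%N ->
  Rpower (INR n) x <= 2 ^ Z.to_nat (ceilR (x * (ln (INR n) / ln 2))).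
Proof.
move=> n2; set y := x * _; set T := Z.to_nat _.
have ln2 : 0 < ln 2 by rewrite -ln_1; apply: ln_increasing; lra.
have yT : y <= INR T by apply: Rle_trans (ceilR_ge y) _; rewrite INR_IZR_INZ; apply: IZR_le; lia.
rewrite -Rpower_pow; last lra.
have -> : Rpower (INR n) x = Rpower 2 y.
  by rewrite /Rpower /y; congr exp; field; lra.
by apply: Rle_Rpower; lra.
Qed.

Theorem mainTheorem5 :
  forall (lam del : R),
    1 / 2 < lam -> 0 < del -> del < Rmin (lam - 1 / 2) 1 ->
    exists Cst : R, 0 < Cst /\
    forall (h : nat -> R) (alpha : R) (gamma : {fset nat} -> R) (d : nat)
           (f : ('I_d -> R) -> C) (n : nat),
      (forall m, 1 <= h m) -> is_lim_seq h p_infty ->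
      1 / 2 < alpha -> lam < alpha ->
      (forall u, 0 < gamma u <= 1) -> gamma fset0 = 1 ->
      (0 < d)%N ->
      inKorobov alpha gamma f ->
      (2 <= n)%N ->
      64 * Vd d alpha lam gamma <= INR n ->
      lam + 1 / 2 <= h n ->
      expectedError h n f <=
        Cst * Rpower (Vd d alpha lam gamma) lam
            * Rpower (INR n) (- lam - 1 / 2 + del) * korobovNorm alpha gamma f.
Proof.
move=> lam del lam_gt del_gt0 del_min.
have del_lt : del < lam - 1 / 2 by apply: Rlt_le_trans del_min (Rmin_l _ _).
have del2 : 0 < del / 2 by lra.
have [cP [cP0 cPP]] := primesP_lower del2.
pose D := dualC del cP; have D0 : 0 < D := dualC_gt0 del_gt0 cP0.
pose q := Rpower 128 (lam - 1 / 2 - del / 2); have q0 : 0 < q := Rpower_gt0 _ _.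
have Dq : 0 < D * q by apply: Rmult_lt_0_compat.
(* The first summand pays for the good draws, with [q] collecting the powers of 128 from [R0]; the
   summand 1 pays for the exceptional event. *)
exists (8 * (D * q) + 1); split; first by lra.
move=> h alpha gamma d f n _ _ _ lam_lt gammaP _ d0 fK n2 _ hn.
set V := Vd _ _ _ _; set A := korobovNorm _ _ _.
have A0 : 0 <= A by apply: sqrt_pos.
have V0 := Rpower_gt0 V lam; have n0 := Rpower_gt0 (INR n) (- lam - 1 / 2 + del).
have n2R : 2 <= INR n by have := INR_leq n2; rewrite /=; lra.
case: (cPP _ n2) => [P0|PL].
  rewrite expectedError_nil //; apply: Rmult_le_pos => //.
  by do 2?[apply: Rmult_le_pos]; lra.
have P_neq0 : primesP n <> [::].
  move=> e; move: PL; rewrite e /=.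
  by have := Rmult_lt_0_compat _ _ cP0 (Rpower_gt0 (INR n) (1 - del / 2)); lra.
have normA N := korobovNorm_partial N fK.
have [_ [fx _]] := fK.
have errlim x : x.1 \in primesP n ->
    is_lim_seq (fun N => Cmod (Cminus (Iint f) (dualsum (fhat f) x N)))
      (Cmod (Cminus (Iint f) (latticeRule f x.1 x.2))).
  case: x => p z /= /mem_primesP[pp _].
  exact: latticeRule_error_lim (prime_gt0 pp) fx.
pose W := A * Rpower V lam.
pose K := D * q * (A * Rpower V lam * Rpower (INR n) (- lam - 1 / 2 + del)).
(* The worst-case bound drops the duality condition and sums over all nonzero frequencies. *)
have errW x : x.1 \in primesP n -> Cmod (Cminus (Iint f) (latticeRule f x.1 x.2)) <= W.
  move=> /errlim L; apply: (lim_le_const _ L) => N.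
  rewrite -fhat0; apply: Rle_trans (dualsum_le _ _ _) _.
  apply: Rle_trans (boxsumR_abs_le lam_gt lam_lt gammaP d0 normA N).
  apply: boxsumR_le => k; case: (dual x k) => /=; first lra.
  by case: ifP => _; have := Cmod_ge_0 (fhat f k); lra.
pose gd := good n lam alpha gamma (d := d).
have errK : Edraw n (fun x =>
    if gd x then Cmod (Cminus (Iint f) (latticeRule f x.1 x.2)) else 0) <= K.
  (* The expectation is a finite sum, so the bound for partial dual sums passes to the limit. *)
  have L : is_lim_seq
      (fun N => Edraw n (fun x => if gd x then Cmod (Cminus (Iint f) (dualsum (fhat f) x N)) else 0))
      (Edraw n (fun x => if gd x then Cmod (Cminus (Iint f) (latticeRule f x.1 x.2)) else 0)).
    apply: is_lim_seq_Edraw => x xP; case: (gd x); [exact: errlim | exact: is_lim_seq_const].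
  apply: (lim_le_const _ L) => N.
  rewrite -fhat0.
  apply: Rle_trans (Edraw_good_dualsum_le lam_gt lam_lt del_gt0 del_lt gammaP d0 n2 P_neq0 cP0 PL normA N) _.
  apply: Req_le; rewrite -/D -/V -/A /K /q.
  have -> : Rpower (INR n / 128) (- (lam - 1 / 2 - del / 2)) =
      Rpower (INR n) (- (lam - 1 / 2 - del / 2)) * Rpower 128 (lam - 1 / 2 - del / 2).
    rewrite -Rpower_mult_distr; [|lra|lra]; congr (_ * _).
    by rewrite /Rpower ln_Rinv; [congr exp; ring | lra].
  (* The rate is the product of the duality probability and the tail decay; each loses [del/2]. *)
  have -> : - lam - 1 / 2 + del = (- 1 + del / 2) + - (lam - 1 / 2 - del / 2) by lra.
  by rewrite [Rpower _ (_ + - (_ - _))]Rpower_plus; ring.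
have bad := Edraw_bad_le lam_gt lam_lt gammaP d0 n2 P_neq0.
have W0 : 0 <= W by apply: Rmult_le_pos; lra.
rewrite /expectedError /Nsamp; set T := Z.to_nat _.
apply: Rle_trans (Edraws_median_le T P_neq0 W0 errW errK bad) _.
(* The sample size gives [2^T >= n^(h n)], and [h n >= lam + 1/2] puts the exceptional event below
   the target rate. *)
have : W / 2 ^ T <= W * Rpower (INR n) (- lam - 1 / 2 + del).
  apply: Rmult_le_compat_l => //.
  apply: (Rle_trans _ (/ Rpower (INR n) (h n))).
    by apply: Rinv_le_contravar; [exact: Rpower_gt0 | exact: pow2_samples_ge].
  by rewrite -Rpower_Ropp; apply: Rle_Rpower; lra.
have -> : (8 * (D * q) + 1) * Rpower V lam * Rpower (INR n) (- lam - 1 / 2 + del) * A =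
  8 * K + W * Rpower (INR n) (- lam - 1 / 2 + del) by rewrite /K /W; ring.
by lra.
Qed.
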